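(* Let $n\ge 1$. The poset $T^\omega_n(W)$ is a contractible Cohen--Macaulay poset of dimension $n-1$.
   Context: $\mathbb{Q}^{2n}$ carries the standard symplectic form $\omega$: on the standard basis $\vec e_1,\vec f_1,\dots,\vec e_n,\vec f_n$ one has $\omega(\vec e_i,\vec e_j)=\omega(\vec f_i,\vec f_j)=0$ for all $i,j$, $\omega(\vec e_i,\vec f_j)=0$ for $i\neq j$, and $\omega(\vec e_i,\vec f_i)=-\omega(\vec f_i,\vec e_i)=1$. A subspace $V$ is isotropic if $\omega|_V=0$. $T^\omega_n$ is the poset of nonzero isotropic subspaces of $\mathbb{Q}^{2n}$ ordered by inclusion. Let $W=\langle \vec e_1,\vec f_1,\dots,\vec e_{n-1},\vec f_{n-1},\vec e_n\rangle_{\mathbb{Q}}$ be the span of all standard basis vectors except $\vec f_n$. $T^\omega_n(W)$ is the subposet of $T^\omega_n$ of those isotropic subspaces that are contained in $W$. Topological properties of a poset refer to its order complex. A simplicial complex is $d$-spherical if it is $d$-dimensional and homotopy equivalent to a (possibly empty) wedge of $d$-spheres, so contractible $d$-dimensional complexes are allowed; the empty complex is $(-1)$-spherical. A poset is Cohen--Macaulay of dimension $d$ if its order complex is $d$-spherical and the link of each $k$-simplex in it is $(d-k-1)$-spherical. *)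

(* Defs.v *)
From HB Require Import structures.
From mathcomp Require Import all_boot all_order all_algebra finmap.
From mathcomp Require Import all_classical all_reals all_analysis wedge_sigT.
Set Implicit Arguments.
Unset Strict Implicit.
Unset Printing Implicit Defensive.
Import Order.TTheory GRing.Theory Num.Theory.
Import numFieldNormedType.Exports.
Local Open Scope classical_set_scope.
Local Open Scope ring_scope.

(** * Homotopy *)

Section Homotopy.
Context (R : realType).

Definition homotopic (X Y : topologicalType) (f g : X -> Y) : Prop :=
  exists H : X * R -> Y,
    [/\ {within [set: X] `*` `[0, 1], continuous H},
        (forall x, H (x, 0) = f x) & (forall x, H (x, 1) = g x)].

Definition homotopy_equivalent (X Y : topologicalType) : Prop :=
  exists (f : X -> Y) (g : Y -> X),
    [/\ continuous f, continuous g,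
        homotopic (g \o f) idfun & homotopic (f \o g) idfun].

Definition contractible (X : topologicalType) : Prop :=
  homotopy_equivalent X (discrete_topology unit).

(* The library norm on row vectors is the sup norm, hence the explicit sum
   of squares. *)
Definition sphere (m : nat) : set 'rV[R]_m.+1 :=
  [set x | \sum_i x ord0 i ^+ 2 = 1].

Arguments sphere : clear implicits.

Lemma sphere_base_subproof (m : nat) :
  (delta_mx ord0 ord0 : 'rV[R]_m.+1) \in sphere m.
Proof.
rewrite inE /sphere /= (bigD1 ord0) //= mxE !eqxx expr1n big1 ?addr0 // => i.
by move=> /negbTE i0; rewrite mxE i0 andbF expr0n.
Qed.

Definition sphere_base (m : nat) : set_type (sphere m) :=
  exist _ (delta_mx ord0 ord0) (sphere_base_subproof m).

(* For empty [I] the library's [wedge] is the empty space and not a point, so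
   this is only meaningful for inhabited [I]. *)
Definition wedge_of_spheres (I : choiceType) (m : nat) : topologicalType :=
  wedge (fun _ : I => sphere_base m).

End Homotopy.

(** * Simplicial complexes *)

Record simplicialComplex (V : choiceType) := SimplicialComplex {
  simplices :> {fset V} -> Prop;
  simplex_neq0 : forall s, simplices s -> s != fset0;
  simplex_face : forall s t, simplices s ->
    t != fset0 -> (t `<=` s)%fset -> simplices t
}.

Definition simplex_dim (V : choiceType) (s : {fset V}) : int := #|` s|%:Z - 1.

Definition has_dim (V : choiceType) (K : simplicialComplex V) (d : int) : Prop :=
  (forall s, K s -> simplex_dim s <= d) /\
  ((exists2 s, K s & simplex_dim s = d) \/ (d = -1 /\ forall s, ~ K s)).

Section Link.
Context (V : choiceType) (K : simplicialComplex V) (s : {fset V}).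

Definition link_simplices : set {fset V} :=
  [set t | [/\ t != fset0, [disjoint s & t]%fset & K (s `|` t)%fset]].

Lemma link_neq0 t : link_simplices t -> t != fset0.
Proof. by case. Qed.

Lemma link_face t u : link_simplices t ->
  u != fset0 -> (u `<=` t)%fset -> link_simplices u.
Proof.
case=> t0 dst Kst u0 ut; split=> //.
  by apply/fdisjointP => x /(fdisjointP dst); apply: contra; apply: (fsubsetP ut).
apply: (simplex_face Kst); last exact: fsetUS.
case/fset0Pn: u0 => x xu; apply/fset0Pn; exists x.
by rewrite in_fsetU xu orbT.
Qed.

Definition link : simplicialComplex V := SimplicialComplex link_neq0 link_face.

End Link.

Section Realization.
Context (R : realType) (V : choiceType) (K : simplicialComplex V).

Definition supported_in (s : {fset V}) (x : V -> R) : Prop :=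
  forall v, v \notin s -> x v = 0.

Definition barycentric (x : V -> R) : Prop :=
  exists s, [/\ K s, supported_in s x, (forall v, 0 <= x v) &
                \sum_(v <- enum_fset s) x v = 1].

Definition realization : Type := {x : V -> R | barycentric x}.

HB.instance Definition _ := gen_eqMixin realization.
HB.instance Definition _ := gen_choiceMixin realization.

(* The weak topology: [U] is open iff its trace on every closed simplex [s] is
   open in [s].  On the points supported in the finite set [s], pointwise
   convergence is the Euclidean topology of the simplex. *)
Definition realization_open (U : set realization) : Prop :=
  forall s, K s -> exists D : set {ptws V -> R}, open D /\
    forall x : realization, supported_in s (sval x) -> (U x <-> D (sval x)).

Lemma realization_openT : realization_open setT.
Proof. by move=> s _; exists setT; split; first exact: openT. Qed.

Lemma realization_openI : setI_closed realization_open.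
Proof.
move=> A B oA oB s Ks.
have [OA [oOA HA]] := oA s Ks; have [OB [oOB HB]] := oB s Ks.
exists (OA `&` OB); split; first exact: openI.
by move=> x sx; split=> -[/HA-/(_ sx) ? /HB-/(_ sx) ?]; split.
Qed.

Lemma realization_open_bigU (I : Type) (f : I -> set realization) :
  (forall i, realization_open (f i)) -> realization_open (\bigcup_i f i).
Proof.
move=> of_ s Ks; have /choice[D HD] := fun i => of_ i s Ks.
exists (\bigcup_i D i); split; first by apply: bigcup_open => i _; case: (HD i).
by move=> x sx; split=> -[i _ fx]; exists i => //; apply/(HD i).2.
Qed.

HB.instance Definition _ := isOpenTopological.Build realization
  realization_openT realization_openI realization_open_bigU.

End Realization.

(* The complex with no simplices is the only one of dimension [-1], and
   [has_dim] excludes all other negative dimensions.  The empty wedge of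
   [m]-spheres is a point. *)
Definition spherical (R : realType) (V : choiceType) (K : simplicialComplex V)
    (d : int) : Prop :=
  has_dim K d /\
  match d with
  | Posz m =>
      contractible R (realization R K) \/
      exists I : choiceType, inhabited I /\
        homotopy_equivalent R (realization R K) (wedge_of_spheres R I m)
  | Negz _ => True
  end.

(** * Posets *)

Section OrderComplex.
Context (disp : Order.disp_t) (P : porderType disp).

Definition chains : set {fset P} :=
  [set s | s != fset0 /\ {in s &, forall x y, (x >=< y)%O}].

Lemma chain_neq0 s : chains s -> s != fset0.
Proof. by case. Qed.

Lemma chain_face s t : chains s -> t != fset0 -> (t `<=` s)%fset -> chains t.
Proof.
case=> _ cs t0 /fsubsetP ts; split=> // x y xt yt.
by apply: cs; apply: ts.
Qed.

Definition order_complex : simplicialComplex P :=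
  SimplicialComplex chain_neq0 chain_face.

Definition cohen_macaulay (R : realType) (d : int) : Prop :=
  spherical R order_complex d /\
  forall s, order_complex s ->
    spherical R (link order_complex s) (d - simplex_dim s - 1).

End OrderComplex.

Arguments order_complex {disp} P.
Arguments cohen_macaulay {disp} P R d.

(** * Isotropic subspaces of the standard symplectic space *)

Section Symplectic.
Context (n : nat).

Local Notation E := 'rV[rat]_(n + n).

(* The basis is listed as e_1, ..., e_n, f_1, ..., f_n, indexed from 0. *)
Definition e_ (i : 'I_n) : E := delta_mx ord0 (lshift n i).
Definition f_ (i : 'I_n) : E := delta_mx ord0 (rshift n i).

Definition omega (u v : E) : rat :=
  \sum_(i < n) (u ord0 (lshift n i) * v ord0 (rshift n i)
                - u ord0 (rshift n i) * v ord0 (lshift n i)).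

Lemma omega_ee i j : omega (e_ i) (e_ j) = 0.
Proof.
by apply: big1 => k _; rewrite !mxE ?eq_lrshift ?eq_rlshift !andbF mulr0 mul0r subrr.
Qed.

Lemma omega_ff i j : omega (f_ i) (f_ j) = 0.
Proof.
by apply: big1 => k _; rewrite !mxE ?eq_lrshift ?eq_rlshift !andbF mulr0 mul0r subrr.
Qed.

Lemma omega_ef i j : omega (e_ i) (f_ j) = (i == j)%:R.
Proof.
rewrite /omega (bigD1 i) //= big1 => [|k /negbTE ki].
  by rewrite !mxE !eqxx !eq_rlshift eq_rshift /= mul0r mul1r subr0 addr0.
by rewrite !mxE !eqxx eq_lshift ki eq_rlshift /= !mul0r subr0.
Qed.

Lemma omega_anti u v : omega v u = - omega u v.
Proof.
rewrite /omega -sumrN; apply: eq_bigr => i _.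
by rewrite opprB mulrC [X in _ - X]mulrC.
Qed.

Definition isotropic (U : {vspace E}) : Prop :=
  {in U &, forall u v, omega u v = 0}.

Definition Tomega : Type :=
  {U : {vspace E} | (U != 0%VS) && `[< isotropic U >]}.

HB.instance Definition _ := SubChoice.on Tomega.

Definition Tomega_le (U V : Tomega) : bool := (val U <= val V)%VS.

Lemma Tomega_le_refl : reflexive Tomega_le.
Proof. by move=> U; exact: subvv. Qed.

Lemma Tomega_le_anti : antisymmetric Tomega_le.
Proof. by move=> U V /subv_anti /val_inj. Qed.

Lemma Tomega_le_trans : transitive Tomega_le.
Proof. by move=> V U W; exact: subv_trans. Qed.

Fact Tomega_display : Order.disp_t.
Proof. exact: Order.Disp tt tt. Qed.

HB.instance Definition _ := Order.Le_isPOrder.Build Tomega_display Tomega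
  Tomega_le_refl Tomega_le_anti Tomega_le_trans.

(* All basis vectors but the last f. *)
Definition W : {vspace E} :=
  (\sum_(i < n) <[e_ i]> + \sum_(i < n | (i.+1 < n)%N) <[f_ i]>)%VS.

Definition TomegaW : Type := {U : Tomega | (val U <= W)%VS}.

HB.instance Definition _ := SubChoice.on TomegaW.
HB.instance Definition _ :=
  [SubChoice_isSubPOrder of TomegaW by <: with Tomega_display].

End Symplectic.

(* Main.v *)
From HB Require Import structures.
From mathcomp Require Import all_boot all_order all_algebra finmap.
From mathcomp Require Import all_classical all_reals all_analysis wedge_sigT.
From mathcomp Require Import ring lra zify.
Require Import Defs.
Set Implicit Arguments.
Unset Strict Implicit.
Unset Printing Implicit Defensive.
Import Order.TTheory GRing.Theory Num.Theory.
Import numFieldNormedType.Exports.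
Local Open Scope classical_set_scope.
Local Open Scope ring_scope.

(** Write [e] for the last basis vector [e_n], so that [W] is the orthogonal
    of [e].  An isotropic [U] in [W] lies in the isotropic subspace [U + <e>],
    which contains [<e>]; this zigzag contracts the whole poset.  For a chain
    [V_1 < ... < V_k], the subspaces comparable with all of its members are
    those below [V_1], those between two successive members and those above
    [V_k], so the link is a join ([spherical_link_poset]).  The pieces other
    than the last are posets of proper subspaces, and the last one is either a
    symplectic building or contractible; all of them are treated at once by
    the Solomon-Tits argument ([spherical_above]).  Above a member [A] of the
    family, choose [H] containing [A], of codimension at most one in every
    [U + H], and [v] in [H] outside [A].  The [U] with [U :&: H <> A] form a
    poset that is contracted by the zigzag
      [U >= U :&: H <= (U :&: H) + <v> >= A + <v>]
    ([deleted_matching]), and the remaining [U] are pairwise incomparable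
    covers of [A], to be attached along the posets above them, which are
    spherical by induction on the codimension.

    To keep all of this combinatorial, sphericity is carried by a perfect
    matching in the sense of discrete Morse theory ([perfect_matching]): all
    chains of the poset, including the empty one, are matched except for a
    set [C] of chains of maximal size.  Such matchings pass to joins
    ([spherical_poset_join]) and can be patched along the fibres of a monotone
    labelling ([perfect_matching_cluster]), which is all that the geometric
    argument uses.

    The topology then has to be extracted from the matching.  Let [L] be the
    subcomplex of the simplices of [K] outside [C], and let [cone] be [K] with
    a cone attached over [L].  Joining the apex to the matched pairs of [L]
    matches the new simplices with one another, so that the cone collapses
    onto [K] ([cone_equivalent]); a collapse of free faces is an explicit
    deformation ([collapse_homotopy_equivalent]).  Inside the new complex the
    part coned off contracts to the apex along straight lines, and one formula
    extends this contraction over the simplices in [C] ([expand]).  Hence the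
    complex is equivalent to its quotient by the part coned off
    ([quotient_homotopy_equivalent]), in which every simplex of [C] has its
    boundary collapsed to the base point: stereographic projection identifies
    it with a sphere ([stereo]), and the quotient with a wedge of spheres
    ([cone_wedge_equivalent]).

    Continuity of all these maps rests on two facts: a product with the line
    preserves final topologies ([final_prod_continuous]), so that homotopies
    may be checked on one closed simplex at a time, and a map into a finite
    subcomplex is continuous as soon as its coordinates are
    ([into_realization_continuous]). *)

(** * Final topologies and homotopies *)

Section FinalTopology.
Context (R : realType).

(** The closed simplices of a complex and the summands of a wedge both
    present their space in this way.  Surjectivity is not implied by the
    condition on open sets, and is needed for products. *)
Definition final_family (I : Type) (T : I -> topologicalType)
    (X : topologicalType) (f : forall i, T i -> X) : Prop :=
  (forall x, exists i y, f i y = x) /\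
  (forall U : set X, (forall i, open (f i @^-1` U)) -> open U).

Lemma final_continuous (I : Type) (T : I -> topologicalType)
    (X Y : topologicalType) (f : forall i, T i -> X) (g : X -> Y) :
  final_family f -> (forall i, continuous (g \o f i)) -> continuous g.
Proof.
move=> [_ fin] cgf; apply/continuousP => U oU; apply: fin => i.
by move/continuousP: (cgf i); apply.
Qed.

(** The line is locally compact: if [J] is a compact interval around
    [t0], the [x] for which [x] times [J] lies in the preimage of an open set
    form an open set, by the tube lemma in each [T i] times [J]. *)
Lemma final_prod_continuous (I : Type) (T : I -> topologicalType)
    (X Y : topologicalType) (f : forall i, T i -> X) (H : X * R -> Y) :
  final_family f -> (forall i, continuous (fun p : T i * R => H (f i p.1, p.2))) ->
  continuous H.
Proof.
move=> [surj fin] cH [x0 t0] N /=.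
have [i0 [y0 <-]] := surj x0.
rewrite nbhsE => -[W [oW Wx WN]].
have : nbhs (y0, t0) [set p : T i0 * R | W (H (f i0 p.1, p.2))].
  by apply: (cH i0 (y0, t0)); apply: open_nbhs_nbhs.
case=> -[A B] /= [Ay Bt] AB.
have [e /= e0 eB] : exists2 e : R, 0 < e & ball t0 e `<=` B by apply/nbhs_ballP.
pose J := `[t0 - e / 2, t0 + e / 2]%classic : set R.
have JB : J `<=` B.
  move=> t; rewrite /J /= in_itv /= => /andP[t1 t2]; apply: eB.
  rewrite -ball_normE /= ltr_norml; apply/andP; split; lra.
have cJ : compact J by exact: segment_compact.
pose U := [set x : X | forall t, J t -> W (H (x, t))].
have oU : open U.
  apply: fin => i; rewrite openE => y Uy /=.
  move/compact_near_coveringP: cJ => /(_ _ (nbhs y) (fun y' t => W (H (f i y', t)))).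
  apply => t Jt.
  have := cH i (y, t) W; rewrite /= => /(_ _)[].
    by apply: open_nbhs_nbhs; split => //; exact: Uy.
  move=> [C D] /= [Cy Dt] CD.
  by exists (D, C) => //= -[t' y'] [/= ? ?]; apply: (CD (y', t')).
exists (U, J) => /=.
  split.
    apply: open_nbhs_nbhs; split => // t Jt.
    by apply: (AB (y0, t)); split => /=; [exact: nbhs_singleton|exact: JB].
  apply/nbhs_ballP; exists (e / 2) => /=; first lra.
  move=> t; rewrite -ball_normE /= ltr_norml /J /= in_itv /= => /andP[? ?].
  by apply/andP; split; lra.
by move=> [x t] [/= Ux Jt]; apply: WN; exact: Ux.
Qed.
End FinalTopology.

Lemma comp_continuous (X Y Z : topologicalType) (f : X -> Y) (g : Y -> Z) :
  continuous f -> continuous g -> continuous (fun x => g (f x)).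
Proof. by move=> cf cg x; apply: continuous_comp; [exact: cf|exact: cg]. Qed.

Lemma pair_continuous (X Y Z : topologicalType) (f : X -> Y) (g : X -> Z) :
  continuous f -> continuous g -> continuous (fun x => (f x, g x)).
Proof. by move=> cf cg x; apply: cvg_pair; [exact: cf|exact: cg]. Qed.

Lemma fst_continuous (X Y : topologicalType) : continuous (@fst X Y).
Proof. by move=> x; exact: cvg_fst. Qed.

Lemma snd_continuous (X Y : topologicalType) : continuous (@snd X Y).
Proof. by move=> x; exact: cvg_snd. Qed.

Section HomotopyTheory.
Context (R : realType).

Definition clamp (t : R) : R := Num.min 1 (Num.max 0 t).

Lemma clamp_itv t : 0 <= clamp t <= 1.
Proof.
by rewrite /clamp le_min ge_min ler01 lexx le_max lexx.
Qed.

Lemma clamp0 : clamp 0 = 0.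
Proof. by rewrite /clamp maxxx min_r. Qed.

Lemma clamp1 : clamp 1 = 1.
Proof. by rewrite /clamp max_r // minxx. Qed.

Lemma clamp_continuous : continuous clamp.
Proof.
move=> t; apply: (@continuous_min R R (fun=> 1) (Num.max 0)); first exact: cst_continuous.
by apply: (@continuous_max R R (fun=> 0) id); first exact: cst_continuous.
Qed.

(** Precomposing with the retraction of the line onto the unit interval
    removes the restriction of continuity to that interval. *)
Lemma homotopicP (X Y : topologicalType) (f g : X -> Y) :
  homotopic R f g <-> exists H : X * R -> Y,
    [/\ continuous H, (forall x, H (x, 0) = f x) & (forall x, H (x, 1) = g x)].
Proof.
split=> -[H [cH H0 H1]]; last first.
  by exists H; split => //; exact: continuous_subspaceT.
exists (fun p => H (p.1, clamp p.2)); split => [p|x|x] /=; last 2 first.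
- by rewrite clamp0.
- by rewrite clamp1.
have Hp : ([set: X] `*` `[(0:R), 1]) (p.1, clamp p.2).
  by split => //=; rewrite in_itv /= clamp_itv.
move/subspace_continuousP: cH => /(_ _ Hp) cH.
apply: cvg_trans cH => N /= HN.
have : nbhs p [set q : X * R | ([set: X] `*` `[(0:R), 1]) (q.1, clamp q.2) ->
   N (H (q.1, clamp q.2))].
  have cp : continuous (fun q : X * R => (q.1, clamp q.2)).
    apply: pair_continuous; first exact: fst_continuous.
    exact: comp_continuous (@snd_continuous _ _) clamp_continuous.
  exact: (cp p _ HN).
apply: filterS => q /=; apply; split => //=; rewrite in_itv /=; exact: clamp_itv.
Qed.

Lemma homotopic_refl (X Y : topologicalType) (f : X -> Y) :
  continuous f -> homotopic R f f.
Proof.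
move=> cf; apply/homotopicP; exists (fun p => f p.1); split => //.
exact: comp_continuous (@fst_continuous _ _) cf.
Qed.

Lemma homotopic_sym (X Y : topologicalType) (f g : X -> Y) :
  homotopic R f g -> homotopic R g f.
Proof.
move=> /homotopicP[H [cH H0 H1]]; apply/homotopicP.
exists (fun p => H (p.1, 1 - p.2)); split => [|x|x] /=; rewrite ?subr0 ?subrr //.
apply: comp_continuous cH; apply: pair_continuous; first exact: fst_continuous.
by move=> p; apply: (@cvgB R R^o); [exact: cvg_cst|exact: cvg_snd].
Qed.

Lemma homotopic_trans (X Y : topologicalType) (f g h : X -> Y) :
  homotopic R f g -> homotopic R g h -> homotopic R f h.
Proof.
move=> /homotopicP[H [cH H0 H1]] /homotopicP[G [cG G0 G1]]; apply/homotopicP.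
pose K (p : X * R) := if p.2 <= 1 / 2 then H (p.1, clamp (2 * p.2))
            else G (p.1, clamp (2 * p.2 - 1)).
exists K; split => [|x|x]; rewrite /K /=; last 2 first.
- by rewrite ifT ?mulr0 ?clamp0 // divr_ge0.
- have -> : (1 <= 1 / 2 :> R) = false by apply/negbTE; rewrite -ltNge; lra.
  by rewrite mulr1 (_ : 2 - 1 = 1 :> R) ?clamp1 //; lra.
have aff (a b : R) : continuous (fun p : X * R => (p.1, clamp (a * p.2 - b))).
  apply: pair_continuous; first exact: fst_continuous.
  apply: comp_continuous clamp_continuous => p.
  apply: (@cvgB R R^o); last exact: cvg_cst.
  by apply: (@cvgM R); [exact: cvg_cst|exact: cvg_snd].
have cHa : continuous (fun p : X * R => H (p.1, clamp (2 * p.2))).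
  apply: comp_continuous cH.
  by have := aff 2 0; under eq_fun do rewrite subr0.
have cGa : continuous (fun p : X * R => G (p.1, clamp (2 * p.2 - 1))).
  exact: comp_continuous (aff 2 1) cG.
have cl (A : set R) : closed A -> closed [set p : X * R | A p.2].
  by move/continuous_closedP: (@snd_continuous X R); apply.
have KH p : p.2 <= 1 / 2 -> K p = H (p.1, clamp (2 * p.2)) by rewrite /K => ->.
have KG p : 1 / 2 <= p.2 -> K p = G (p.1, clamp (2 * p.2 - 1)).
  rewrite /K => p2; case: ifP => // p2'.
  have -> : p.2 = 1 / 2 by apply/eqP; rewrite eq_le p2 p2'.
  have -> : 2 * (1 / 2) = 1 :> R by lra.
  by rewrite subrr clamp0 clamp1 H1 G0.
apply/continuous_subspace_setT.
rewrite (_ : setT = [set p : X * R | p.2 <= 1 / 2] `|` [set p : X * R | 1 / 2 <= p.2]); last first.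
  by apply/seteqP; split => // p _ /=; case: (leP p.2 (1 / 2)) => ?; [left|right; lra].
apply: withinU_continuous; [exact: (cl _ (@closed_le R (1 / 2)))
                           |exact: (cl _ (@closed_ge R (1 / 2)))| |].
- apply: (subspace_eq_continuous _ (continuous_subspaceT cHa)).
  by move=> p /set_mem p2; exact/esym/KH.
- apply: (subspace_eq_continuous _ (continuous_subspaceT cGa)).
  by move=> p /set_mem p2; exact/esym/KG.
Qed.

Lemma homotopic_comp (X Y Z V : topologicalType) (f g : Y -> Z) (a : X -> Y) (b : Z -> V) :
  continuous a -> continuous b -> homotopic R f g ->
  homotopic R (b \o f \o a) (b \o g \o a).
Proof.
move=> ca cb /homotopicP[H [cH H0 H1]]; apply/homotopicP.
exists (fun p => b (H (a p.1, p.2))); split => [|x|x] /=; rewrite ?H0 ?H1 //.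
apply: comp_continuous cb; apply: comp_continuous cH.
apply: pair_continuous; last exact: snd_continuous.
exact: comp_continuous (@fst_continuous _ _) ca.
Qed.

Lemma homotopy_equivalent_sym (X Y : topologicalType) :
  homotopy_equivalent R X Y -> homotopy_equivalent R Y X.
Proof. by move=> [f [g [cf cg gf fg]]]; exists g, f. Qed.

Lemma homotopy_equivalent_trans (X Y Z : topologicalType) :
  homotopy_equivalent R X Y -> homotopy_equivalent R Y Z -> homotopy_equivalent R X Z.
Proof.
move=> [f [g [cf cg gf fg]]] [h [k [ch ck kh hk]]].
exists (h \o f), (g \o k); split.
- exact: comp_continuous cf ch.
- exact: comp_continuous ck cg.
- exact: homotopic_trans (homotopic_comp cf cg kh) gf.
- exact: homotopic_trans (homotopic_comp ck ch fg) hk.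
Qed.

End HomotopyTheory.

(** Collapsing [A] to a point is an equivalence as soon as a
    deformation of the pair contracts [A]: the final map of the deformation
    factors through the quotient and gives the inverse, and the deformation
    itself descends because it preserves [A]. *)
Lemma quotient_homotopy_equivalent (R : realType) (X Z : topologicalType)
    (f : X -> Z) (A : set X) (G : X * R -> X) :
  continuous f -> final_family (fun _ : unit => f) ->
  (forall x y, f x = f y <-> x = y \/ (A x /\ A y)) ->
  continuous G -> (forall x, G (x, 0) = x) ->
  (forall x t, A x -> A (G (x, t))) ->
  (forall x y, A x -> A y -> G (x, 1) = G (y, 1)) ->
  homotopy_equivalent R X Z.
Proof.
move=> cf ff fE cG G0 GA G1.
have /choice[s sK] : forall z, exists x, f x = z.
  by move=> z; have [_ [x fx]] := ff.1 z; exists x.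
pose Hz (p : Z * R) := f (G (s p.1, p.2)).
have HzE x t : Hz (f x, t) = f (G (x, t)).
  rewrite /Hz /=; have /fE[->//|[As Ax]] := sK (f x).
  by apply/fE; right; split; apply: GA.
exists f, (fun z => G (s z, 1)); split => //.
- apply: (final_continuous ff) => _ /=.
  have -> : (fun z => G (s z, 1)) \o f = fun x => G (x, 1).
    by apply/funext => x /=; have /fE[->//|[? ?]] := sK (f x); exact: G1.
  apply: comp_continuous cG; apply: pair_continuous => x; [exact: cvg_id|exact: cvg_cst].
- apply: homotopic_sym; apply/homotopicP; exists G; split => // x /=.
  by have /fE[->//|[? ?]] := sK (f x); exact: G1.
- apply: homotopic_sym; apply/homotopicP; exists Hz; split => [|z|z].
  + apply: (final_prod_continuous ff) => _.
    have -> : (fun p : X * R => Hz (f p.1, p.2)) = f \o G.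
      by apply/funext => -[x t]; rewrite HzE.
    exact: comp_continuous cG cf.
  + by rewrite /Hz /= G0 sK.
  + by [].
Qed.

(** * Topology of the geometric realization *)

Lemma ptws_continuous (Z : topologicalType) (I : eqType) (T : topologicalType)
    (h : Z -> {ptws I -> T}) :
  (forall i, continuous (fun z => h z i)) -> continuous h.
Proof.
move=> ch z; apply/cvg_sup => i A [_ [[B oB <-] /= Bz BA]].
by apply: filterS (BA) _; apply: ch; exact: open_nbhs_nbhs.
Qed.

Section Realizations.
Context (R : realType) (V : choiceType).

Definition closed_simplex (s : {fset V}) : set {ptws V -> R} :=
  [set x | [/\ supported_in s x, (forall v, 0 <= x v) & \sum_(v <- enum_fset s) x v = 1]].

Lemma simplex_barycentric (K : simplicialComplex V) (s : {fset V}) (x : V -> R) :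
  K s -> closed_simplex s x -> barycentric K x.
Proof. by move=> Ks [? ? ?]; exists s. Qed.

Definition simplex_incl (K : simplicialComplex V) (s : {fset V}) (Ks : K s)
    (x : closed_simplex s) : realization R K :=
  exist _ (set_val x) (simplex_barycentric Ks (set_valP x)).

(** The two sums differ only by terms that vanish, so the mass of a
    barycentric point can be computed on any set that contains its support. *)
Lemma sum_supported (s t : {fset V}) (x : V -> R) : supported_in s x ->
  (forall v, v \in s -> v \in t \/ x v = 0) ->
  \sum_(v <- enum_fset s) x v = \sum_(v <- enum_fset t) x v.
Proof.
move=> sx st; rewrite [LHS](bigID (mem t)) /= [X in _ + X]big_seq_cond.
rewrite [X in _ + X]big1 ?addr0; last first.
  by move=> v /andP[/st[->|//]].
rewrite [RHS](bigID (mem s)) /= [X in _ = _ + X]big1 ?addr0; last first.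
  by move=> v vs; apply: sx.
rewrite -big_filter -[RHS]big_filter; apply: perm_big; apply: uniq_perm.
- by rewrite filter_uniq // fset_uniq.
- by rewrite filter_uniq // fset_uniq.
- by move=> v; rewrite !mem_filter andbC.
Qed.

Lemma sum_supported2 (s t : {fset V}) (x : V -> R) :
  supported_in s x -> supported_in t x ->
  \sum_(v <- enum_fset s) x v = \sum_(v <- enum_fset t) x v.
Proof.
move=> sx tx; apply: sum_supported => // v _.
by case: (boolP (v \in t)) => vt; [left|right; exact: tx].
Qed.

Lemma realization_eq (K : simplicialComplex V) (x y : realization R K) :
  (forall v, sval x v = sval y v) -> x = y.
Proof. by case: x y => [x bx] [y by_] /= /funext xy; exact: eq_exist. Qed.

Lemma realization_ge0 (K : simplicialComplex V) (x : realization R K) v : 0 <= sval x v.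
Proof. by case: x => x [s [? ? /= ->]]. Qed.

Lemma realization_supp (K : simplicialComplex V) (x : realization R K) (F : {fset V}) :
  supported_in F (sval x) ->
  exists s, [/\ K s, (s `<=` F)%fset & closed_simplex s (sval x)].
Proof.
case: x => x [s [Ks sx x0 x1]] /= Fx.
have sF : supported_in (s `&` F)%fset x.
  by move=> v; rewrite in_fsetI negb_and => /orP[/sx|/Fx].
exists (s `&` F)%fset; split.
- apply: (simplex_face Ks); last exact: fsubsetIl.
  apply/eqP => s0; move: x1; rewrite (sum_supported2 sx sF) s0 big_nil.
  by move/eqP; rewrite eq_sym oner_eq0.
- exact: fsubsetIr.
- by split => //; rewrite -(sum_supported2 sx sF).
Qed.

Lemma realization_final (K : simplicialComplex V) :
  final_family (fun i : {s | K s} => @simplex_incl K (sval i) (svalP i)).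
Proof.
split => [[x bx]|U oU].
  have [s [Ks sx x0 x1]] := bx.
  have xs : closed_simplex s x by [].
  by exists (exist _ s Ks), (SigSub (mem_set xs)); apply: realization_eq.
move=> s Ks; have [D oD DU] := oU (exist _ s Ks).
exists D; split => // x sx.
have xs : closed_simplex s (sval x).
  case: x sx => x [t [Kt tx x0 x1]] /= sx; split => //.
  by rewrite -(sum_supported2 tx sx).
have xE : x = simplex_incl Ks (SigSub (mem_set xs)) by exact: realization_eq.
suff E : D (sval x) = U (simplex_incl Ks (SigSub (mem_set xs))) by rewrite [in U x]xE -E.
have := congr1 (fun S : set (closed_simplex s) => S (SigSub (mem_set xs))) DU.
rewrite /preimage /= set_valE => ->; congr U; exact: realization_eq.
Qed.

(** Only finitely many simplices have their vertices in [F], and on each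
    of them the weak topology is the one given by the coordinates. *)
Lemma into_realization_continuous (K : simplicialComplex V) (Z : topologicalType)
    (h : Z -> realization R K) (F : {fset V}) :
  (forall z, supported_in F (sval (h z))) ->
  (forall v, continuous (fun z => sval (h z) v)) -> continuous h.
Proof.
move=> hF ch; have cph : continuous (fun z => sval (h z) : {ptws V -> R}).
  exact: ptws_continuous.
apply/continuousP => U oU; rewrite openE => z /= Uz.
have : nbhs z (\bigcap_(s in [set` fpowerset F])
    [set z' | K s -> supported_in s (sval (h z')) -> U (h z')]).
  apply: filter_bigI => s _.
  have [Ks|nKs] := pselect (K s); last by apply: nearW => z' /nKs.
  have [D [oD DU]] := oU s Ks.
  have [sz|/existsNP[v /not_implyP[vs /eqP zv]]] := pselect (supported_in s (sval (h z))).
    have : nbhs z [set z' | D (sval (h z'))].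
      by apply: cph; apply: open_nbhs_nbhs; split => //; apply/DU.
    by apply: filterS => z' Dz' _ sz'; apply/DU.
  have : nbhs z [set z' | sval (h z') v != 0].
    apply: (ch v z [set r | r != 0]); apply: open_nbhs_nbhs; split => //.
  by apply: filterS => z' zv' _ /(_ _ vs) /eqP; rewrite (negbTE zv').
apply: filterS => z' Hz'.
have [s [Ks sF [sz _ _]]] := realization_supp (hF z').
by apply: (Hz' s) => //=; rewrite fpowersetE.
Qed.

Lemma simplex_coord_continuous (s : {fset V}) (v : V) :
  continuous (fun x : closed_simplex s => (set_val x : {ptws V -> R}) v).
Proof.
apply: (@comp_continuous _ {ptws V -> R} _ set_val (fun x => x v)).
  exact: initial_continuous.
exact: proj_continuous.
Qed.

Lemma simplex_incl_continuous (K : simplicialComplex V) (s : {fset V}) (Ks : K s) :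
  continuous (simplex_incl Ks).
Proof.
apply: (@into_realization_continuous _ _ _ s) => [z|v].
  by have [] := set_valP z.
exact: simplex_coord_continuous.
Qed.

End Realizations.
Arguments closed_simplex R {V} s.

Section MinCoord.
Context (R : realType) (V : choiceType).

(** The minimum starts from [1], which bounds all barycentric
    coordinates, to make sense for the empty set as well. *)
Definition mincoord (s : {fset V}) (x : V -> R) : R :=
  \big[Num.min/1]_(w <- enum_fset s) x w.

Lemma mincoord_le (s : {fset V}) (x : V -> R) w : w \in s -> mincoord s x <= x w.
Proof.
rewrite /mincoord -[w \in s]/(w \in enum_fset s).
elim: (enum_fset s) => // v r IH; rewrite inE big_cons => /orP[/eqP->|/IH wr].
  by rewrite ge_min lexx.
by rewrite ge_min wr orbT.
Qed.

Lemma mincoord_ge (s : {fset V}) (x : V -> R) (r : R) :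
  r <= 1 -> (forall w, w \in s -> r <= x w) -> r <= mincoord s x.
Proof.
move=> r1 rx; rewrite /mincoord big_seq.
by elim/big_ind : _ => // a b ra rb; rewrite le_min ra.
Qed.

Lemma mincoord_attained (s : {fset V}) (x : V -> R) :
  s != fset0 -> (forall w, w \in s -> x w <= 1) ->
  exists2 w, w \in s & x w = mincoord s x.
Proof.
move=> /fset0Pn[w0 w0s] x1.
have : mincoord s x = 1 \/ exists2 w, w \in s & x w = mincoord s x.
  rewrite /mincoord big_seq; elim/big_ind : _ => [|a b|w ws]; first by left.
  - by move=> ? ?; case: leP.
  - by right; exists w.
case=> // m1; exists w0 => //; apply/eqP; rewrite eq_le mincoord_le // m1 x1 //.
Qed.

Lemma continuous_mincoord (Z : topologicalType) (s : {fset V}) (f : Z -> V -> R) :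
  (forall v, continuous (fun z => f z v)) -> continuous (fun z => mincoord s (f z)).
Proof.
move=> cf; rewrite /mincoord; elim: (enum_fset s) => [|v r IH].
  by under eq_fun do rewrite big_nil; move=> z; exact: cvg_cst.
under eq_fun do rewrite big_cons; move=> z.
by apply: (@continuous_min R Z (fun z => f z v)); [exact: cf|exact: IH].
Qed.

Lemma continuousD (Z : topologicalType) (f g : Z -> R) :
  continuous f -> continuous g -> continuous (fun z => f z + g z).
Proof. by move=> cf cg z; apply: (@cvgD R R^o); [exact: cf|exact: cg]. Qed.

Lemma continuousB (Z : topologicalType) (f g : Z -> R) :
  continuous f -> continuous g -> continuous (fun z => f z - g z).
Proof. by move=> cf cg z; apply: (@cvgB R R^o); [exact: cf|exact: cg]. Qed.

Lemma continuousM (Z : topologicalType) (f g : Z -> R) :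
  continuous f -> continuous g -> continuous (fun z => f z * g z).
Proof. by move=> cf cg z; apply: (@cvgM R); [exact: cf|exact: cg]. Qed.

Lemma continuous_cst (Z : topologicalType) (r : R) : continuous (fun _ : Z => r).
Proof. by move=> z; exact: cvg_cst. Qed.

End MinCoord.

Section Carrier.
Context (R : realType) (V : choiceType) (K : simplicialComplex V).
Implicit Type x : realization R K.

(** The support of [x]: evaluating formulas there rather than on an
    arbitrary simplex containing [x] makes them functions of [x] alone. *)
Lemma carrier_subproof x : exists c, [/\ K c, supported_in c (sval x) &
  forall v, v \in c -> sval x v != 0].
Proof.
case: x => x bx; have [s [Ks sx x0 x1]] := bx.
pose c := [fset v in s | x v != 0]%fset.
have cx : supported_in c x.
  move=> v; rewrite !inE /= negb_and negbK => /orP[/sx//|/eqP //].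
have [t [Kt tc [tx _ _]]] := @realization_supp R V K (exist _ x bx) c cx.
suff ct : (c `<=` t)%fset.
  exists c; split => // [|v]; last by rewrite !inE => /andP[].
  by have -> : c = t by apply/eqP; rewrite eqEfsubset ct.
apply/fsubsetP => v; rewrite !inE /= => /andP[_]; apply: contraR => /tx /= ->.
by rewrite eqxx.
Qed.

Definition carrier x : {fset V} := projT1 (cid (carrier_subproof x)).

Lemma carrier_simplex x : K (carrier x).
Proof. by rewrite /carrier; case: cid => c []. Qed.

Lemma carrier_supp x : supported_in (carrier x) (sval x).
Proof. by rewrite /carrier; case: cid => c []. Qed.

Lemma carrier_neq0 x v : v \in carrier x -> sval x v != 0.
Proof. by rewrite /carrier; case: cid => c [? ? c0] /=; exact: c0. Qed.

Lemma carrier_sub x (s : {fset V}) : supported_in s (sval x) -> (carrier x `<=` s)%fset.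
Proof.
rewrite /carrier; case: cid => c [? ? c0] /= sx.
by apply/fsubsetP => v /c0; apply: contraR => /sx ->.
Qed.

Lemma carrier_le x (s : {fset V}) : (carrier x `<=` s)%fset -> supported_in s (sval x).
Proof. by move=> /fsubsetP cs v vs; apply: carrier_supp; apply: contra vs => /cs. Qed.

Lemma realization_sum x (s : {fset V}) : supported_in s (sval x) ->
  \sum_(v <- enum_fset s) sval x v = 1.
Proof.
move=> sx; have [t [_ _ [tx _ <-]]] := realization_supp sx.
exact: sum_supported2.
Qed.

Lemma realization_le1 x v : sval x v <= 1.
Proof.
have cx := @carrier_supp x.
case: (boolP (v \in carrier x)) => [vc|/cx ->//].
rewrite -(realization_sum cx) (big_rem v) //= lerDl.
by apply: sumr_ge0 => w _; exact: realization_ge0.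
Qed.
End Carrier.

(** * Perfect matchings on families of finite sets *)

Definition toggle (V : choiceType) (v : V) (c : {fset V}) : {fset V} :=
  (if v \in c then c `\ v else v |` c)%fset.

Section Matchings.
Context (V : choiceType).
Implicit Types (c d : {fset V}) (F : set {fset V}) (v : V) (S : {pred V}).

Definition restr S c : {fset V} := [fset x in c | x \in S]%fset.

Lemma in_restr S c x : (x \in restr S c) = (x \in c) && (x \in S).
Proof. by rewrite !inE. Qed.

Lemma restrS S c d : (c `<=` d)%fset -> (restr S c `<=` restr S d)%fset.
Proof.
by move=> /fsubsetP cd; apply/fsubsetP => x; rewrite !in_restr => /andP[/cd -> ->].
Qed.

Lemma in_toggle v c x : (x \in toggle v c) = (x \in c) (+) (x == v).
Proof.
rewrite /toggle; case: (boolP (v \in c)) => vc; rewrite !inE.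
  by case: eqVneq => [->|_]; rewrite ?vc ?addbF.
by case: eqVneq => [->|_]; rewrite ?(negbTE vc) ?addbF.
Qed.

(** An acyclic matching as in discrete Morse theory, without critical
    elements: [c] is matched with [toggle (a c) c], and the rank strictly
    increases from the lower member of a pair to every larger member of [F]
    outside the pair.  Removing the pairs of the highest rank, then those of
    the next one, is a sequence of collapses; the bound [N] makes the sequence
    finite even when [F] is infinite.  The family is not required to be closed
    under subsets and may contain the empty set. *)
Definition perfect_matching F (N : nat) : Prop :=
  exists (a : {fset V} -> V) (rho : {fset V} -> nat),
  (forall c, F c -> [/\ F (toggle (a c) c), a (toggle (a c) c) = a c,
     rho (toggle (a c) c) = rho c & (rho c < N)%N]) /\
  (forall c d, F c -> F d -> a c \notin c -> (c `<=` d)%fset ->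
     [\/ d = c, d = (a c |` c)%fset | (rho c < rho d)%N]).

Lemma perfect_matching_leq F N N' : (N <= N')%N ->
  perfect_matching F N -> perfect_matching F N'.
Proof.
move=> NN' [a [rho [aF cF]]]; exists a, rho; split => // c /aF[? ? ? rN].
by split => //; exact: leq_trans NN'.
Qed.

Lemma perfect_matching0 F F0 N N0 : perfect_matching F0 N0 -> (forall c, ~ F c) ->
  perfect_matching F N.
Proof. by move=> [a [rho _]] F_0; exists a, rho; split => [c|c d] /F_0. Qed.

(** The number of vertices other than [p] is a rank for the matching that
    adds or removes [p]. *)
Lemma perfect_matching_cone F (p : V) (D : nat) :
  (forall c, F c -> F (toggle p c)) -> (forall c, F c -> (#|` c| <= D)%N) ->
  perfect_matching F D.+1.
Proof.
move=> Fp FD; exists (fun=> p), (fun c => #|` (c `\ p)%fset|); split.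
  move=> c Fc; split => //; first exact: Fp.
    congr (#|` _|); apply/fsetP => x; rewrite !in_fsetD1 in_toggle.
    by case: eqVneq => //=; rewrite addbF.
  by rewrite ltnS (leq_trans _ (FD _ Fc)) // fsubset_leq_card // fsubD1set.
move=> c d Fc Fd pc cd.
have sub : (c `\ p `<=` d `\ p)%fset.
  by apply/fsubsetP => x; rewrite !in_fsetD1 => /andP[-> /(fsubsetP cd)].
case: (boolP (d `<=` p |` c)%fset) => dpc.
  case: (boolP (p \in d)) => pd.
    apply: Or32; apply/eqP; rewrite eqEfsubset dpc /=.
    by apply/fsubsetP => x; rewrite !inE => /orP[/eqP->|/(fsubsetP cd)].
  apply: Or31; apply/eqP; rewrite eqEfsubset cd andbT.
  apply/fsubsetP => x xd; have := fsubsetP dpc x xd; rewrite !inE.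
  by case: eqVneq xd => // ->; rewrite (negbTE pd).
apply: Or33; apply: fproper_ltn_card; rewrite fproperE sub.
apply: contra dpc => /fsubsetP dc; apply/fsubsetP => x xd; have := dc x.
by rewrite !inE xd andbT; case: eqVneq => //= _; apply.
Qed.

(** The patchwork principle: along a monotone labelling the fibres may be
    matched independently, since the pairs over a higher label are removed
    first. *)
Lemma perfect_matching_cluster F (L : Type) (lab : {fset V} -> L) (ht : L -> nat)
    (N H : nat) :
  (forall c, F c -> (ht (lab c) < H)%N) ->
  (forall c d, F c -> F d -> (c `<=` d)%fset ->
     lab c = lab d \/ (ht (lab c) < ht (lab d))%N) ->
  (forall l, perfect_matching [set c | F c /\ lab c = l] N) ->
  perfect_matching F (H * N).
Proof.
move=> htH labm /choice[A] /choice[P] AP.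
exists (fun c => A (lab c) c), (fun c => ht (lab c) * N + P (lab c) c)%N.
split => [c Fc|c d Fc Fd ac cd].
  have [/(_ c)[]// [Ft labt] at_ rt rN _] := AP (lab c).
  rewrite labt at_ rt; split => //.
  have := htH _ Fc; move: rN; nia.
have [lcd|] := labm _ _ Fc Fd cd.
  have [_ /(_ c d)] := AP (lab c).
  case => //; [exact: Or31|exact: Or32|move=> r; apply: Or33].
  by rewrite -lcd ltn_add2l.
move=> hcd; apply: Or33; have [/(_ c)[]// _ _ _ rN _] := AP (lab c).
nia.
Qed.

(** The labelling by the part of [c] in [S], with its size as height. *)
Lemma perfect_matching_split F S (D N : nat) :
  (forall c, F c -> (#|` c| <= D)%N) ->
  (forall e, perfect_matching [set c | F c /\ restr S c = e] N) ->
  perfect_matching F (D.+1 * N).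
Proof.
move=> FD; apply: (@perfect_matching_cluster _ _ _ (fun e => #|` e|)) => [c Fc|c d _ _ cd].
  rewrite ltnS (leq_trans _ (FD _ Fc)) // fsubset_leq_card //.
  by apply/fsubsetP => x; rewrite in_restr => /andP[].
have := restrS S cd; rewrite fsubEproper => /orP[/eqP|/fproper_ltn_card]; by [left|right].
Qed.

(** Adding a fixed set [B] of vertices outside [S] to all members of a
    family carries its matching along. *)
Lemma perfect_matching_restr F F0 S B (N : nat) :
  (forall c, F0 c -> forall x, x \in c -> x \in S) ->
  (forall c, F c <-> F0 (restr S c) /\ restr [predC S] c = B) ->
  perfect_matching F0 N -> perfect_matching F N.
Proof.
move=> F0S FE [a [rho [aF cF]]].
exists (fun c => a (restr S c)), (fun c => rho (restr S c)).
have aS c : F0 c -> a c \in S.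
  move=> F0c; have [F0t _ _ _] := aF _ F0c.
  case: (boolP (a c \in c)) => ac; first exact: (F0S c).
  by apply: (F0S _ F0t); rewrite in_toggle eqxx (negbTE ac).
have rt c : F c -> restr S (toggle (a (restr S c)) c) = toggle (a (restr S c)) (restr S c).
  move=> /FE[/aS as_ _]; apply/fsetP => x; rewrite !(in_restr, in_toggle).
  by case: eqVneq => [->|]; rewrite ?as_ ?andbT ?addbF ?andbF.
split => [c Fc|c d Fc Fd].
  have [F0c cB] := (FE c).1 Fc; have [F0t at_ rt_ rN] := aF _ F0c.
  rewrite rt //; split => //; apply/FE; rewrite rt //; split => //.
  rewrite -cB; apply/fsetP => x; rewrite !(in_restr, in_toggle) !inE /=.
  by case: eqVneq => [->|]; rewrite ?aS ?andbF ?addbF.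
move=> /= ac cd.
have [F0c cB] := (FE c).1 Fc; have [F0d dB] := (FE d).1 Fd.
have outside x : x \notin S -> (x \in d) = (x \in c).
  move=> xS; move: (cB); rewrite -dB => /fsetP/(_ x).
  by rewrite !in_restr !inE xS !andbT.
have [|E|E|] := cF _ _ F0c F0d _ (restrS S cd).
- by rewrite in_restr negb_and ac.
- apply: Or31; apply/fsetP => x; case: (boolP (x \in S)) => xS; last exact: outside.
  by move/fsetP: E => /(_ x); rewrite !in_restr xS !andbT.
- apply: Or32; apply/fsetP => x; case: (boolP (x \in S)) => xS.
    by move/fsetP: E => /(_ x); rewrite !inE xS !andbT.
  rewrite outside // !inE; case: eqVneq => // E'; move: xS.
  by rewrite E' aS.
- by move=> ?; apply: Or33.
Qed.

End Matchings.

(** * Collapsing free faces *)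

Section Collapse.
Context (R : realType) (V : choiceType) (K K' : simplicialComplex V).
Context (a : {fset V} -> V).
Hypothesis K'K : forall t, K' t -> K t.
Hypothesis togK : forall t, K t -> ~ K' t ->
  [/\ K (toggle (a t) t), ~ K' (toggle (a t) t) & a (toggle (a t) t) = a t].
Hypothesis free : forall t d, K t -> ~ K' t -> a t \notin t -> K d ->
  (t `<=` d)%fset -> d = t \/ d = (a t |` t)%fset.

Let lo (t : {fset V}) := (t `\ a t)%fset.
Let hi (t : {fset V}) := (a t |` t)%fset.

Let lo_notin t : a t \notin lo t.
Proof. by rewrite /lo in_fsetD1 eqxx. Qed.

Let lohi t : (a t |` lo t)%fset = hi t.
Proof.
apply/fsetP => v; rewrite /lo /hi !inE; case: eqVneq => //=.
Qed.

Let loP t : K t -> ~ K' t -> [/\ K (lo t), ~ K' (lo t) & a (lo t) = a t].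
Proof.
move=> Kt nKt; case: (boolP (a t \in t)) => att.
  by have := togK Kt nKt; rewrite /toggle att.
suff -> : lo t = t by [].
by apply/fsetP => v; rewrite /lo !inE; case: eqVneq => // ->; rewrite (negbTE att).
Qed.

Let hiP t : K t -> ~ K' t -> [/\ K (hi t), ~ K' (hi t) & a (hi t) = a t].
Proof.
move=> Kt nKt; case: (boolP (a t \in t)) => att; last first.
  by have := togK Kt nKt; rewrite /toggle (negbTE att).
suff -> : hi t = t by [].
by apply/fsetP => v; rewrite /hi !inE; case: eqVneq => // ->; rewrite att.
Qed.

(** A simplex that contains the lower member of a pair belongs to this
    pair, by freeness. *)
Let pair_unique t s : K t -> ~ K' t -> K s -> (lo t `<=` s)%fset ->
  a s = a t /\ lo s = lo t.
Proof.
move=> Kt nKt Ks ts; have [Kl nKl al] := loP Kt nKt.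
have := @free (lo t) s Kl nKl; rewrite al => /(_ (lo_notin t) Ks ts).
have lolo : lo (lo t) = lo t.
  by apply/fsetP => v; rewrite {1}/lo al !inE; case: eqVneq.
case=> [->//|]; rewrite lohi => ->; have [_ _ ah] := hiP Kt nKt.
split => //; apply/fsetP => v; rewrite /lo ah /hi !inE.
by case: eqVneq.
Qed.

(** The point moves in the direction from the barycentre of [s] to [v],
    until for [u = 1] a coordinate in [s] vanishes.  Nothing moves if such a
    coordinate is zero from the start, which is what makes the formulas on
    different simplices agree. *)
Definition push (v : V) (s : {fset V}) (u : R) (x : V -> R) (w : V) : R :=
  x w + u * mincoord s x * (if w == v then #|` s|%:R else if w \in s then -1 else 0).

Lemma sum_push v s u x : v \notin s ->
  \sum_(w <- enum_fset (v |` s)%fset) push v s u x w =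
  \sum_(w <- enum_fset (v |` s)%fset) x w.
Proof.
move=> vs; rewrite /push big_split /= -mulr_sumr.
rewrite [X in _ * X](_ : _ = 0) ?mulr0 ?addr0 //.
rewrite (big_fsetD1 v) /=; last by rewrite !inE eqxx.
rewrite eqxx fsetU1K // big_seq (eq_bigr (fun=> -1)); last first.
  by move=> w ws; rewrite ws; case: eqVneq ws => // ->; rewrite (negbTE vs).
rewrite -big_seq big_const_seq count_predT iter_addr addr0 cardfE.
by rewrite mulNrn subrr.
Qed.

Lemma push_ge0 v s u x w : 0 <= u <= 1 -> (forall w, 0 <= x w) -> v \notin s ->
  0 <= push v s u x w.
Proof.
move=> /andP[u0 u1] x0 vs; have m0 : 0 <= mincoord s x by apply: mincoord_ge.
rewrite /push; case: eqVneq => _; first by rewrite addr_ge0 // !mulr_ge0.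
case: ifP => ws; last by rewrite mulr0 addr0.
rewrite mulrN1 subr_ge0 (le_trans _ (mincoord_le x ws)) //.
by rewrite ler_piMl.
Qed.

Lemma push_id v s u x : mincoord s x = 0 -> push v s u x = x.
Proof. by move=> m0; apply/funext => w; rewrite /push m0 mulr0 mul0r addr0. Qed.

Lemma push_continuous (Z : topologicalType) v s (u : Z -> R) (x : Z -> V -> R) w :
  continuous u -> (forall v, continuous (fun z => x z v)) ->
  continuous (fun z => push v s (u z) (x z) w).
Proof.
move=> cu cx; apply: continuousD; first exact: cx.
apply: continuousM; last exact: continuous_cst.
by apply: continuousM => //; exact: continuous_mincoord.
Qed.

Definition deform (x : realization R K) (u : R) : V -> R :=
  let c := carrier x in
  if `[< K' c >] then sval x else push (a c) (c `\ a c)%fset (clamp u) (sval x).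

Lemma deform_good (x : realization R K) u s :
  K' s -> supported_in s (sval x) -> deform x u = sval x.
Proof.
move=> K's sx; rewrite /deform asboolT //.
apply: (simplex_face K's); last exact: carrier_sub.
exact: simplex_neq0 (carrier_simplex x).
Qed.

(** The formula may be read in any simplex [s] around [x]: either the
    carrier of [x] lies in the same pair as [s], or it misses a vertex of the
    lower member of that pair and [push] is the identity. *)
Lemma deform_bad (x : realization R K) u s :
  K s -> ~ K' s -> supported_in s (sval x) ->
  deform x u = push (a s) (s `\ a s)%fset (clamp u) (sval x).
Proof.
move=> Ks nKs sx; rewrite /deform; case: asboolP => [Kc|nKc].
  have [Kl nKl _] := loP Ks nKs.
  have [w ws wc] : exists2 w, w \in lo s & w \notin carrier x.
    apply/fsubsetPn/negP => lc; apply: nKl.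
    exact: (simplex_face Kc (simplex_neq0 Kl)).
  rewrite push_id //; apply/eqP; rewrite eq_le mincoord_ge //; last first.
    by move=> v _; exact: realization_ge0.
  by rewrite -(carrier_supp wc) mincoord_le.
have [] := @pair_unique (carrier x) s (@carrier_simplex _ _ _ x) nKc Ks.
  by apply: fsubset_trans (carrier_sub sx); exact: fsubD1set.
by rewrite /lo => -> ->.
Qed.

Lemma push_supp v s u x : supported_in (v |` s)%fset x ->
  supported_in (v |` s)%fset (push v s u x).
Proof.
move=> sx w; rewrite /push => wvs; rewrite sx //; move: wvs.
rewrite !inE => /norP[/negbTE -> /negbTE ->]; by rewrite mulr0 addr0.
Qed.

Lemma deform_barycentric x u : barycentric K (deform x u).
Proof.
rewrite /deform; case: asboolP => [_|nKc]; first exact: svalP.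
set c := carrier x in nKc *.
have Kc : K c := carrier_simplex x.
have [Kh nKh _] := hiP Kc nKc.
have hx : supported_in (hi c) (sval x).
  by apply: carrier_le; exact: fsubsetUr.
exists (hi c); split => //.
- rewrite -lohi; apply: push_supp; by rewrite lohi.
- move=> w; apply: push_ge0 => [||]; [exact: clamp_itv|exact: realization_ge0|exact: lo_notin].
- by rewrite -lohi sum_push ?lo_notin // lohi realization_sum.
Qed.

(** At time [1] a coordinate [w] of the lower member has vanished, and the
    facet opposite to [w] of the upper member has been kept: otherwise it
    would contain the lower member, hence [w]. *)
Lemma deform1_barycentric x : barycentric K' (deform x 1).
Proof.
rewrite /deform clamp1; case: asboolP => [Kc|nKc].
  have [t [Kt tc tx]] := realization_supp (@carrier_supp _ _ _ x).
  by exists (carrier x); have [? ? ?] := tx; split => //;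
    [exact: carrier_supp|exact: realization_sum (@carrier_supp _ _ _ x)].
set c := carrier x in nKc *.
have Kc : K c := carrier_simplex x.
have [Kh nKh ah] := hiP Kc nKc.
have [Kl nKl al] := loP Kc nKc.
have hx : supported_in (a c |` lo c)%fset (sval x).
  by rewrite lohi; apply: carrier_le; exact: fsubsetUr.
have [w wl xw] : exists2 w, w \in lo c & sval x w = mincoord (lo c) (sval x).
  apply: mincoord_attained; first exact: simplex_neq0 Kl.
  by move=> w _; exact: realization_le1.
set y := push _ _ _ _.
have wa : w != a c by apply: contraTneq wl => ->; exact: lo_notin.
have yw : y w = 0.
  by rewrite /y /push (negbTE wa) xw mul1r ifT // mulrN1 subrr.
pose t := (hi c `\ w)%fset.
have yt : supported_in t y.
  move=> v; rewrite /t !inE negb_and negbK => /orP[/eqP->//|vh].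
  by apply: (@push_supp (a c) (lo c)) => //; rewrite lohi /hi !inE.
have wh : w \in hi c by rewrite -lohi in_fsetU wl orbT.
have at_ : a c \in t by rewrite /t /hi !inE eqxx eq_sym wa.
have t0 : t != fset0 by apply/fset0Pn; exists (a c).
have Kt : K t by apply: (simplex_face Kh) => //; exact: fsubD1set.
have K't : K' t.
  apply: contrapT => nKt.
  have [] := @pair_unique t (hi c) Kt nKt Kh.
    by apply: fsubset_trans (fsubD1set _ _); exact: fsubD1set.
  rewrite ah => at1 lt; have : w \in lo (hi c) by rewrite /lo ah in_fsetD1 wa wh.
  by rewrite lt /lo /t !inE eqxx andbF.
exists t; split => //.
- by move=> v; apply: push_ge0 => [||]; [rewrite ler01 lexx|exact: realization_ge0|exact: lo_notin].
- rewrite (@sum_supported2 _ _ t (a c |` lo c)%fset) //; last exact: push_supp.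
  by rewrite /y sum_push ?lo_notin // realization_sum.
Qed.

Definition deform_map (p : realization R K * R) : realization R K :=
  exist _ (deform p.1 p.2) (deform_barycentric p.1 p.2).

Definition collapse_map (x : realization R K) : realization R K' :=
  exist _ (deform x 1) (deform1_barycentric x).

Lemma deform_continuous (L : simplicialComplex V) s (Ks : K s) (Z : topologicalType)
    (h : Z -> realization R L) (x : Z -> closed_simplex R s) (u : Z -> R) :
  continuous x -> continuous u ->
  (forall z, sval (h z) = deform (simplex_incl Ks (x z)) (u z)) -> continuous h.
Proof.
move=> cx cu hE.
have cxv v : continuous (fun z => sval (simplex_incl Ks (x z)) v).
  exact: comp_continuous cx (@simplex_coord_continuous _ _ _ v).
have sx z : supported_in s (sval (simplex_incl Ks (x z))).
  by have [] := set_valP (x z).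
have [K's|nKs] := pselect (K' s).
  apply: (@into_realization_continuous _ _ _ _ h s) => [z|v].
    by rewrite hE (deform_good _ K's).
  have -> : (fun z => sval (h z) v) = fun z => sval (simplex_incl Ks (x z)) v.
    by apply/funext => z; rewrite hE (deform_good _ K's).
  exact: cxv.
have E z := deform_bad (u z) Ks nKs (sx z).
apply: (@into_realization_continuous _ _ _ _ h (hi s)) => [z|v].
  rewrite hE E -lohi; apply: push_supp; rewrite lohi => w wh.
  by apply: sx; apply: contra wh => ws; rewrite !inE ws orbT.
have -> : (fun z => sval (h z) v) = fun z =>
    push (a s) (lo s) (clamp (u z)) (sval (simplex_incl Ks (x z))) v.
  by apply/funext => z; rewrite hE E.
apply: push_continuous; last exact: cxv.
exact: comp_continuous cu (@clamp_continuous R).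
Qed.

Lemma sub_barycentric (x : realization R K') : barycentric K (sval x).
Proof. by case: x => x [s [Ks ? ? ?]]; exists s; split => //; exact: K'K. Qed.

Definition sub_incl (x : realization R K') : realization R K :=
  exist _ (sval x) (sub_barycentric x).

Lemma sub_incl_continuous : continuous sub_incl.
Proof.
apply: (final_continuous (@realization_final R V K')) => -[s Ks] /=.
apply: (@into_realization_continuous _ _ _ _ _ s) => [z|v] /=.
  by have [] := set_valP z.
exact: simplex_coord_continuous.
Qed.

(** All the free pairs are collapsed at the same time, each inside its
    upper member. *)
Lemma collapse_homotopy_equivalent :
  homotopy_equivalent R (realization R K) (realization R K').
Proof.
exists collapse_map, sub_incl; split.
- apply: (final_continuous (@realization_final R V K)) => -[s Ks] /=.
  apply: (@deform_continuous _ s (svalP (exist _ s Ks)) _ _ id (fun=> 1)) => //.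
    by move=> x; exact: cvg_id.
  exact: continuous_cst.
- exact: sub_incl_continuous.
- apply: homotopic_sym; apply/homotopicP; exists deform_map; split => [|x|x].
  + apply: (final_prod_continuous (@realization_final R V K)) => -[s Ks] /=.
    apply: (@deform_continuous _ s (svalP (exist _ s Ks)) _ _ fst snd) => //.
      exact: fst_continuous.
    exact: snd_continuous.
  + apply: realization_eq => v /=; rewrite /deform clamp0; case: asboolP => // _.
    by rewrite /push !mul0r addr0.
  + exact: realization_eq.
- have -> : collapse_map \o sub_incl = idfun.
    apply/funext => x; apply: realization_eq => v /=.
    have [s [Ks _ [sx _ _]]] := realization_supp (@carrier_supp _ _ _ x).
    by rewrite (@deform_good (sub_incl x) 1 s Ks).
  by apply: homotopic_refl => x; exact: cvg_id.
Qed.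

End Collapse.

(** The pairs of the highest rank are free, so they can be collapsed, and
    what remains is a complex because the rank is monotone. *)
Lemma matching_homotopy_equivalent (R : realType) (V : choiceType)
    (K K' : simplicialComplex V) (N : nat) :
  (forall t, K' t -> K t) -> perfect_matching [set t | K t /\ ~ K' t] N ->
  homotopy_equivalent R (realization R K) (realization R K').
Proof.
move=> K'K [a [rho [aF cF]]].
elim: N K K'K aF cF => [|N IH] K K'K aF cF.
  have no t : K t -> ~ K' t -> False by move=> Kt nKt; have [_ _ _] := aF t (conj Kt nKt).
  by apply: (@collapse_homotopy_equivalent _ _ _ _ a) => // [t Kt /(no _ Kt)|t d Kt /(no _ Kt)].
pose L t := K' t \/ [/\ K t, ~ K' t & (rho t < N)%N].
have rhoS t u : K t -> ~ K' t -> K u -> ~ K' u -> (u `<=` t)%fset -> (rho u <= rho t)%N.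
  move=> Kt nKt Ku nKu ut; have [[Ktu nKtu] atu rtu _] := aF u (conj Ku nKu).
  case: (boolP (a u \in u)) => au; last first.
    case: (cF u t) => // [->|->|/ltnW] //.
    by move: rtu; rewrite /toggle (negbTE au) => ->.
  have E : toggle (a u) u = (u `\ a u)%fset by rewrite /toggle au.
  rewrite -rtu; case: (cF (toggle (a u) u) t) => //.
  - by rewrite atu in_toggle au eqxx.
  - by rewrite E; apply: fsubset_trans ut; exact: fsubD1set.
  - by move=> ->.
  - by rewrite atu E fsetD1K // => ->; rewrite -rtu E.
  - exact: ltnW.
have L0 t : L t -> t != fset0.
  by case=> [/simplex_neq0 //|[/simplex_neq0]].
have Lface t u : L t -> u != fset0 -> (u `<=` t)%fset -> L u.
  move=> Lt u0 ut; have [K'u|nKu] := pselect (K' u); [by left|right].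
  case: Lt => [K't|[Kt nKt rt]]; first by case: nKu; exact: (simplex_face K't).
  have Ku : K u by exact: (simplex_face Kt).
  by split => //; apply: leq_ltn_trans rt; exact: rhoS.
pose KL := SimplicialComplex L0 Lface.
have KLK t : KL t -> K t by case=> [/K'K|[]].
have badE t : K t -> ~ KL t -> ~ K' t /\ rho t = N.
  move=> Kt nLt; have nKt : ~ K' t by move=> K't; apply: nLt; left.
  split => //; have [_ _ _] := aF t (conj Kt nKt); rewrite ltnS leq_eqVlt => /orP[/eqP //|rt].
  by case: nLt; right.
apply: (homotopy_equivalent_trans (Y := realization R KL)).
- apply: (@collapse_homotopy_equivalent _ _ _ _ a) => // [t Kt nLt|t d Kt nLt att Kd td].
    have [nKt rt] := badE t Kt nLt; have [[Ktt nKtt] att rtt _] := aF t (conj Kt nKt).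
    by split => //; case=> // -[_ _]; rewrite rtt rt ltnn.
  have [nKt rt] := badE t Kt nLt.
  have nLd : ~ KL d.
    by move=> Ld; apply: nLt; apply: (Lface d) => //; exact: simplex_neq0 Kt.
  have [nKd rd] := badE d Kd nLd.
  case: (cF t d) => // [->|->|]; [by left|by right|by rewrite rt rd ltnn].
- apply: IH => [t|t [[K't|[Kt nKt rt]] nKt']|c d [Lc nc] [Ld nd]]; first by left.
  + by [].
  + have [[Ktt nKtt] att rtt _] := aF t (conj Kt nKt); split => //; split => //.
    by right; rewrite rtt.
  + by apply: cF; split => //; exact: KLK.
Qed.

(** * Coning off the matched simplices *)

Section Lower.
Context (V : choiceType).
Implicit Types (c d : {fset V}) (t s : {fset option V}).

(** The apex of the cone is [None]; [lower] forgets it. *)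
Definition lower t : {fset V} := [fset v | v in pmap id (enum_fset t)]%fset.

Definition raise c : {fset option V} := [fset Some v | v in c]%fset.

Lemma in_lower t v : (v \in lower t) = (Some v \in t).
Proof. by rewrite !inE mem_pmap map_id. Qed.

Lemma some_in_raise c v : (Some v \in raise c) = (v \in c).
Proof. by rewrite mem_imfset //= => x y []. Qed.

Lemma none_in_raise c : (None \in raise c) = false.
Proof. by apply/imfsetP => -[]. Qed.

Lemma raiseK c : lower (raise c) = c.
Proof. by apply/fsetP => v; rewrite in_lower some_in_raise. Qed.

Lemma lowerK t : None \notin t -> raise (lower t) = t.
Proof.
by move=> nt; apply/fsetP => -[v|]; rewrite ?some_in_raise ?in_lower // none_in_raise (negbTE nt).
Qed.

Lemma lowerS t s : (t `<=` s)%fset -> (lower t `<=` lower s)%fset.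
Proof. by move=> /fsubsetP ts; apply/fsubsetP => v; rewrite !in_lower; exact: ts. Qed.

Lemma lower_none t : lower (None |` t)%fset = lower t.
Proof. by apply/fsetP => v; rewrite !in_lower !inE. Qed.

Lemma lower_toggle v t : lower (toggle (Some v) t) = toggle v (lower t).
Proof.
by apply/fsetP => w; rewrite in_lower !in_toggle in_lower.
Qed.

Lemma lower_eq0 t : None \notin t -> t != fset0 -> lower t != fset0.
Proof.
move=> nt /fset0Pn[[v|]]; last by rewrite (negbTE nt).
by move=> vt; apply/fset0Pn; exists v; rewrite in_lower.
Qed.

Lemma sum_lower (R : realType) t (f : option V -> R) :
  \sum_(o <- enum_fset t) f o =
  (if None \in t then f None else 0) + \sum_(v <- enum_fset (lower t)) f (Some v).
Proof.
rewrite (bigID (pred1 None)) /=; congr (_ + _).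
  case: ifP => nt; last first.
    rewrite big_seq_cond big1 // => o /andP[ot /eqP o0].
    by move: ot; rewrite o0; rewrite -[_ \in _]/(None \in t) nt.
  rewrite big_mkcond (big_fsetD1 None nt) /= big_seq big1 ?addr0 // => o.
  by rewrite !inE => /andP[/negbTE->].
rewrite -big_filter -(big_map Some xpredT f); apply: perm_big; apply: uniq_perm.
- by rewrite filter_uniq // fset_uniq.
- by rewrite map_inj_uniq ?fset_uniq // => x y [].
- move=> o; rewrite mem_filter; case: o => [v|] /=.
    rewrite mem_map; last by move=> x y [].
    by rewrite -[RHS]/(v \in lower t) in_lower.
  by apply/esym/mapP => -[].
Qed.

End Lower.

Section Cone.
Context (R : realType) (V : choiceType) (K : simplicialComplex V) (C : set {fset V}).
Context (e : nat).
Hypothesis K_size : forall c, K c -> (#|` c| <= e)%N.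
Hypothesis C_top : forall c, C c -> K c /\ #|` c| = e.
Implicit Types (c d : {fset V}) (t s : {fset option V}).

Definition aug c : Prop := c = fset0 \/ K c.
(** The subcomplex outside [C], together with the empty simplex, over
    which the cone is taken. *)
Definition coned c : Prop := aug c /\ ~ C c.

Lemma aug_face c d : aug c -> (d `<=` c)%fset -> aug d.
Proof.
move=> Kc dc; have [->|d0] := eqVneq d fset0; [by left|right].
case: Kc => [c0|Kc]; last exact: (simplex_face Kc).
by move: dc; rewrite c0 fsubset0 (negbTE d0).
Qed.

Lemma coned_face c d : coned c -> (d `<=` c)%fset -> coned d.
Proof.
move=> [Kc nCc] dc; split; first exact: aug_face dc.
move=> Cd; have [Kd de] := C_top Cd; apply: nCc.
suff <- : d = c by [].
apply/eqP; rewrite eqEfcard dc de /=; case: Kc => [->|/K_size //].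
by rewrite cardfs0.
Qed.

(** Members of [C] have the maximal size, so none is a proper face of
    another one. *)
Lemma top_facet c d : C c -> (d `<=` c)%fset -> d != c -> coned d.
Proof.
move=> Cc dc ndc; have [Kc ce] := C_top Cc; split; first exact: aug_face (or_intror Kc) dc.
move=> Cd; have [_ de] := C_top Cd; move: ndc.
by rewrite eqEfcard dc ce de leqnn.
Qed.

Definition cone_simplices t : Prop :=
  [/\ t != fset0, aug (lower t) & None \in t -> coned (lower t)].

Lemma cone_neq0 t : cone_simplices t -> t != fset0.
Proof. by case. Qed.

Lemma cone_face t s : cone_simplices t -> s != fset0 -> (s `<=` t)%fset ->
  cone_simplices s.
Proof.
move=> [t0 Kt Lt] s0 st; split => //; first exact: aug_face (lowerS st).
by move=> /(fsubsetP st)/Lt Lt'; exact: coned_face (lowerS st).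
Qed.

Definition cone := SimplicialComplex cone_neq0 cone_face.

Definition base_simplices t : Prop := None \notin t /\ K (lower t).

Lemma base_neq0 t : base_simplices t -> t != fset0.
Proof.
move=> [_ /simplex_neq0]; apply: contra => /eqP ->; apply/eqP/fsetP => v.
by rewrite in_lower.
Qed.

Lemma base_face t s : base_simplices t -> s != fset0 -> (s `<=` t)%fset ->
  base_simplices s.
Proof.
move=> [nt Kt] s0 st; have ns : None \notin s by apply: contra nt; apply: (fsubsetP st).
by split => //; apply: (simplex_face Kt); [exact: lower_eq0|exact: lowerS].
Qed.

Definition base := SimplicialComplex base_neq0 base_face.

(** The simplices that contain the apex correspond to the members of
    [coned], including the empty one, and inherit their matching. *)
Lemma cone_base_equivalent N : perfect_matching coned N ->
  homotopy_equivalent R (realization R cone) (realization R base).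
Proof.
move=> [a [rho [aF cF]]].
have badE t : cone t /\ ~ base t <-> None \in t /\ coned (lower t).
  split=> [[[t0 Kt Lt] nb]|[nt Lt]].
    have nt : None \in t.
      apply: contrapT => /negP nt; apply: nb; split => //.
      by case: Kt => // l0; move: (lower_eq0 nt t0); rewrite l0 eqxx.
    by split => //; exact: Lt.
  split; last by case; rewrite nt.
  by split => //; [apply/fset0Pn; exists None|case: Lt].
apply: (@matching_homotopy_equivalent _ _ _ _ N) => [t [nt Kt]|].
  split; [exact: base_neq0 (conj nt Kt)|by right|by rewrite (negbTE nt)].
exists (fun t => Some (a (lower t))), (fun t => rho (lower t)); split.
  move=> t /badE[nt Lt]; have [Lt' at_ rt rN] := aF _ Lt.
  rewrite lower_toggle at_ rt; split => //; apply/badE; rewrite lower_toggle; split => //.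
  by rewrite in_toggle nt.
move=> t s /badE[nt Lt] /badE[ns Ls]; rewrite -in_lower => att ts.
have EN t' s' : None \in t' -> None \in s' -> lower s' = lower t' -> s' = t'.
  move=> nt' ns' E; apply/fsetP => -[v|]; last by rewrite nt' ns'.
  by rewrite -!in_lower E.
have [E|E|?] := cF _ _ Lt Ls att (lowerS ts).
- by apply: Or31; exact: EN.
- apply: Or32; apply: EN => //; first by rewrite !inE.
  by rewrite E; apply/fsetP => v; rewrite in_lower !in_fset1U in_lower.
- by apply: Or33.
Qed.

Lemma raise_base c : K c -> base (raise c).
Proof. by move=> Kc; split; rewrite ?none_in_raise // raiseK. Qed.

Lemma base_bary_lower (x : option V -> R) : barycentric base x -> barycentric K (x \o Some).
Proof.
move=> [t [[nt Kt] tx x0 x1]]; exists (lower t); split => //.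
- by move=> v; rewrite in_lower => /tx.
- by move=> v; exact: x0.
- by move: x1; rewrite sum_lower (negbTE nt) add0r.
Qed.

Definition extend0 (x : V -> R) (o : option V) : R := if o is Some v then x v else 0.

Lemma bary_extend0 (x : V -> R) : barycentric K x -> barycentric base (extend0 x).
Proof.
move=> [c [Kc cx x0 x1]]; exists (raise c); split.
- exact: raise_base.
- by case=> [v|] //=; rewrite some_in_raise => /cx.
- by case.
- by rewrite sum_lower none_in_raise add0r raiseK.
Qed.

Definition base_to (x : realization R base) : realization R K :=
  exist _ _ (base_bary_lower (svalP x)).
Definition to_base (x : realization R K) : realization R base :=
  exist _ _ (bary_extend0 (svalP x)).

Lemma base_equivalent : homotopy_equivalent R (realization R base) (realization R K).
Proof.
exists base_to, to_base; split.
- apply: (final_continuous (@realization_final R _ base)) => -[s Ks] /=.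
  apply: (@into_realization_continuous _ _ _ _ _ (lower s)) => [z v vs|v] /=.
    by have [sz _ _] := set_valP z; apply: sz; rewrite -in_lower.
  exact: simplex_coord_continuous.
- apply: (final_continuous (@realization_final R _ K)) => -[s Ks] /=.
  apply: (@into_realization_continuous _ _ _ _ _ (raise s)) => [z [v|]|[v|]] //=.
  + by move=> vs; have [sz _ _] := set_valP z; apply: sz; rewrite -some_in_raise.
  + exact: simplex_coord_continuous.
  + exact: continuous_cst.
- have -> : to_base \o base_to = idfun.
    apply/funext => x; apply: realization_eq => -[v|] //=.
    by case: x => x [t [[nt _] tx _ _]] /=; rewrite tx.
  by apply: homotopic_refl => x; exact: cvg_id.
- have -> : base_to \o to_base = idfun.
    by apply/funext => x; exact: realization_eq.
  by apply: homotopic_refl => x; exact: cvg_id.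
Qed.

Lemma cone_equivalent N : perfect_matching coned N ->
  homotopy_equivalent R (realization R K) (realization R cone).
Proof.
move=> /cone_base_equivalent ?; apply: homotopy_equivalent_sym.
exact: homotopy_equivalent_trans base_equivalent.
Qed.

End Cone.

(** * Contracting the cone *)

Section ConeDeformation.
Context (R : realType) (V : choiceType).
Implicit Types (c d : {fset V}) (t s : {fset option V}) (y : option V -> R).

Definition shrink (u : R) y (o : option V) : R :=
  (1 - u) * y o + (if o is None then u else 0).

(** How far the radial expansion from the barycentre by the factor
    [1 + u] leaves the simplex, scaled so as to equal [u] on the boundary. *)
Definition overshoot c (u : R) y : R :=
  Num.max 0 (u - (1 + u) * (#|` c|%:R * mincoord c (y \o Some))).

(** Radial expansion by the factor [1 + u]; a point that leaves the
    simplex by the amount [k] stops at the boundary and is moved from there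
    towards the apex, to the point whose coordinate at the apex is [k].  With
    [q] vertices, adding [k / q] to all coordinates and dividing by [1 + k] is
    the radial projection back to the boundary. *)
Definition expand c (u : R) y (o : option V) : R :=
  let k := overshoot c u y in
  if o is Some v then
    if v \in c then
      (1 - k) * (y (Some v) + u * (y (Some v) - #|` c|%:R^-1) + k / #|` c|%:R) / (1 + k)
    else 0
  else k.

Lemma overshoot_ge0 c u y : 0 <= overshoot c u y.
Proof. by rewrite /overshoot le_max lexx. Qed.

Lemma overshoot_le c u y : 0 <= u -> (forall o, 0 <= y o) -> overshoot c u y <= u.
Proof.
move=> u0 y0; have m0 : 0 <= mincoord c (y \o Some) by apply: mincoord_ge => // ? _; exact: y0.
rewrite /overshoot ge_max u0 /= gerBl; apply: mulr_ge0; [lra|exact: mulr_ge0].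
Qed.

Section OneSimplex.
Context (c : {fset V}) (u : R) (y : option V -> R).
Hypothesis c0 : c != fset0.
Hypothesis u01 : 0 <= u <= 1.
Hypothesis y0 : forall o, 0 <= y o.
Let q : R := #|` c|%:R.
Let k := overshoot c u y.
Let m := mincoord c (y \o Some).

Let q_gt0 : 0 < q.
Proof. by rewrite /q ltr0n lt0n cardfs_eq0. Qed.

Let k_ge0 : 0 <= k. Proof. exact: overshoot_ge0. Qed.

Let k_le1 : k <= 1.
Proof. by have /andP[u0 u1] := u01; exact: le_trans (overshoot_le _ u0 y0) u1. Qed.

Lemma expand_ge0 o : 0 <= expand c u y o.
Proof.
have /andP[u0 u1] := u01; have k0 := k_ge0; have k1 := k_le1; have q0 := q_gt0.
case: o => [v|] /=; last exact: k_ge0.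
case: ifP => vc //; rewrite -/k -/q.
apply: mulr_ge0; last by rewrite invr_ge0; lra.
apply: mulr_ge0; first by rewrite subr_ge0.
have yv : m <= y (Some v) by exact: (mincoord_le (y \o Some) vc).
have kq : u - (1 + u) * (q * m) <= k by rewrite /k /overshoot le_max lexx orbT.
have -> : y (Some v) + u * (y (Some v) - q^-1) + k / q =
   ((1 + u) * (q * y (Some v)) - u + k) / q by field; rewrite gt_eqF.
apply: divr_ge0; last exact: ltW.
have : (1 + u) * (q * m) <= (1 + u) * (q * y (Some v)).
  by rewrite ler_pM2l ?ler_pM2l //; lra.
lra.
Qed.

Lemma sum_expand : \sum_(v <- enum_fset c) y (Some v) = 1 ->
  \sum_(v <- enum_fset c) expand c u y (Some v) = 1 - k.
Proof.
move=> y1; have k0 := k_ge0; have q0 := q_gt0; rewrite big_seq /=.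
rewrite (eq_bigr (fun v => (1 - k) / (1 + k) * ((1 + u) * y (Some v) + (k - u) / q))); last first.
  move=> v vc; rewrite vc -/k -/q; field.
  by rewrite (gt_eqF q_gt0) gt_eqF //; lra.
rewrite -big_seq -mulr_sumr big_split /= -mulr_sumr y1 mulr1.
rewrite big_const_seq count_predT iter_addr addr0 -[_ *+ _]mulr_natr -/q.
field; rewrite (gt_eqF q_gt0) gt_eqF //; lra.
Qed.

(** A point with positive coordinate at the apex has been stopped on a
    facet, and so stays inside the cone over that facet. *)
Lemma expand_vanish : (forall o, y o <= 1) -> 0 < k ->
  exists2 v, v \in c & expand c u y (Some v) = 0.
Proof.
move=> y1 k0; have q0 := q_gt0; have [v vc yv] : exists2 v, v \in c & (y \o Some) v = m.
  by apply: mincoord_attained => // v vc; exact: y1.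
exists v => //=; rewrite vc -/k -/q.
have kE : k = u - (1 + u) * (q * m).
  rewrite /k /overshoot max_r //; apply: ltW.
  by move: k0; rewrite /k /overshoot lt_max ltxx.
rewrite -[y (Some v)]/((y \o Some) v) yv.
suff -> : m + u * (m - q^-1) + k / q = 0 by rewrite mulr0 mul0r.
by rewrite kE; field; rewrite gt_eqF.
Qed.

(** On the boundary the expansion is the straight-line contraction to
    the apex. *)
Lemma expand_boundary : m = 0 -> (forall v, v \notin c -> y (Some v) = 0) -> y None = 0 ->
  expand c u y = shrink u y.
Proof.
move=> m0 yc yN; have kE : k = u.
  rewrite /k /overshoot -/m -/q m0 !mulr0 subr0 max_r //.
  by case/andP: u01.
apply/funext => -[v|] /=; rewrite -/k kE /shrink; last by rewrite yN mulr0 add0r.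
rewrite addr0; case: ifP => vc; last by rewrite yc ?vc // mulr0.
rewrite -/q; have /andP[? ?] := u01; field.
by rewrite (gt_eqF q_gt0) gt_eqF //; lra.
Qed.

Lemma expand0 : u = 0 -> (forall v, v \notin c -> y (Some v) = 0) -> y None = 0 ->
  expand c u y = y.
Proof.
move=> uE yc yN.
have kE : k = 0.
  rewrite /k /overshoot -/m -/q uE addr0 mul1r sub0r max_l // oppr_le0.
  apply: mulr_ge0; first exact: ltW.
  by apply: mincoord_ge => // v _; exact: y0.
apply/funext => -[v|] /=; rewrite -/k kE ?yN //.
case: ifP => vc; last by rewrite yc ?vc.
by rewrite uE subr0 mul1r !mul0r !addr0 divr1.
Qed.

End OneSimplex.

Lemma continuousV (Z : topologicalType) (f : Z -> R) :
  (forall z, f z != 0) -> continuous f -> continuous (fun z => (f z)^-1).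
Proof. by move=> f0 cf z; apply: cvgV => //; exact: cf. Qed.

Lemma overshoot_continuous (Z : topologicalType) c (u : Z -> R) (y : Z -> option V -> R) :
  continuous u -> (forall o, continuous (fun z => y z o)) ->
  continuous (fun z => overshoot c (u z) (y z)).
Proof.
move=> cu cy z; apply: (@continuous_max R Z (fun=> 0)); first exact: continuous_cst.
apply: continuousB => //; apply: continuousM.
  by apply: continuousD => //; exact: continuous_cst.
apply: continuousM; first exact: continuous_cst.
by apply: continuous_mincoord => v; exact: cy.
Qed.

Lemma expand_continuous (Z : topologicalType) c (u : Z -> R) (y : Z -> option V -> R) o :
  continuous u -> (forall o, continuous (fun z => y z o)) ->
  continuous (fun z => expand c (u z) (y z) o).
Proof.
move=> cu cy; have ck := @overshoot_continuous Z c u y cu cy.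
have cst := @continuous_cst R Z.
case: o => [v|] //=; case: (v \in c) => //.
apply: continuousM.
  apply: continuousM; first exact: continuousB.
  apply: continuousD; last exact: continuousM.
  by apply: continuousD => //; apply: continuousM => //; exact: continuousB.
apply: continuousV; last exact: continuousD.
by move=> z; rewrite gt_eqF // ltr_pwDl // overshoot_ge0.
Qed.

Lemma shrink_continuous (Z : topologicalType) (u : Z -> R) (y : Z -> option V -> R) o :
  continuous u -> (forall o, continuous (fun z => y z o)) ->
  continuous (fun z => shrink (u z) (y z) o).
Proof.
move=> cu cy; have cst := @continuous_cst R Z.
apply: continuousD; last by case: o.
by apply: continuousM => //; exact: continuousB.
Qed.

End ConeDeformation.

Section ConeDeformationMap.
Context (R : realType) (V : choiceType) (K : simplicialComplex V) (C : set {fset V}).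
Context (e : nat).
Hypothesis K_size : forall c, K c -> (#|` c| <= e)%N.
Hypothesis C_top : forall c, C c -> K c /\ #|` c| = e.
Implicit Types (c d : {fset V}) (t s : {fset option V}) (y : option V -> R).

Local Notation Kc := (cone K_size C_top).
Local Notation X := (realization R Kc).
Local Notation coned := (coned K C).
Local Notation core y := (lower (carrier y)).

Definition cone_deform (y : X) (u : R) : option V -> R :=
  if `[< C (core y) >] then expand (core y) (clamp u) (sval y)
  else shrink (clamp u) (sval y).

Definition cone_part : set X := [set y | coned (core y)].

Lemma cone_alt s : Kc s -> coned (lower s) \/ C (lower s).
Proof. by move=> [_ Ks _]; have [|] := pselect (C (lower s)); [right|left]. Qed.

Lemma top_none s : Kc s -> C (lower s) -> None \notin s.
Proof. by move=> [_ _ Ls] Cs; apply/negP => /Ls[_]. Qed.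

Lemma top_neq0 c : C c -> c != fset0.
Proof. by move=> /C_top[/simplex_neq0]. Qed.

Lemma core_sub (y : X) s : supported_in s (sval y) -> (core y `<=` lower s)%fset.
Proof. by move=> /carrier_sub; exact: lowerS. Qed.

Lemma core_out (y : X) v : v \notin core y -> sval y (Some v) = 0.
Proof. by rewrite in_lower => /carrier_supp. Qed.

Lemma cone_part_supp (y : X) s : coned (lower s) -> supported_in s (sval y) -> cone_part y.
Proof. by move=> Ls sy; apply: (coned_face K_size C_top Ls); exact: core_sub. Qed.

Lemma cone_deform_coned (y : X) u : cone_part y ->
  cone_deform y u = shrink (clamp u) (sval y).
Proof. by move=> [_ nC]; rewrite /cone_deform asboolF. Qed.

(** On the faces of a simplex of [C] both formulas defining the
    deformation agree, by [expand_boundary]. *)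
Lemma cone_deform_top (y : X) u s : Kc s -> C (lower s) -> supported_in s (sval y) ->
  cone_deform y u = expand (lower s) (clamp u) (sval y).
Proof.
move=> Ks Cs sy; rewrite /cone_deform; case: asboolP => [Cy|nCy].
  congr expand; apply/eqP; rewrite eqEfcard core_sub //=.
  by have [_ ->] := C_top Cs; have [_ ->] := C_top Cy.
rewrite expand_boundary //.
- exact: top_neq0.
- exact: clamp_itv.
(* The carrier is a proper face, so some coordinate on [lower s] is zero. *)
- have [v vs vy] : exists2 v, v \in lower s & v \notin core y.
    apply/fsubsetPn/negP => sy'; apply: nCy; suff -> : core y = lower s by [].
    by apply/eqP; rewrite eqEfsubset sy' core_sub.
  apply/eqP; rewrite eq_le mincoord_ge //; last by move=> *; exact: realization_ge0.
  by rewrite -(core_out vy) andbT; exact: (mincoord_le (sval y \o Some)).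
- by move=> v vs; apply: sy; rewrite -in_lower.
- by apply: sy; exact: top_none.
Qed.

Lemma cone_deform_ge0 (y : X) u o : 0 <= cone_deform y u o.
Proof.
rewrite /cone_deform; case: asboolP => [Cy|_].
  by apply: expand_ge0; [exact: top_neq0|exact: clamp_itv|move=> ?; exact: realization_ge0].
have /andP[u0 u1] := clamp_itv u.
rewrite /shrink addr_ge0 //; last by case: o.
by rewrite mulr_ge0 ?subr_ge0 // realization_ge0.
Qed.

Lemma cone_deform_supp (y : X) u :
  supported_in (None |` carrier y)%fset (cone_deform y u).
Proof.
move=> o; rewrite !inE => /norP[oN oc]; rewrite /cone_deform.
case: o oN oc => // v _ vy; case: asboolP => Cy /=.
  by rewrite in_lower (negbTE vy).
by rewrite /shrink (carrier_supp vy) mulr0 addr0.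
Qed.

Lemma cone_deform_sum (y : X) u :
  \sum_(o <- enum_fset (None |` carrier y)%fset) cone_deform y u o = 1.
Proof.
have sumy := realization_sum (@carrier_supp _ _ _ y).
rewrite sum_lower !inE eqxx lower_none /=.
rewrite /cone_deform; case: asboolP => [Cy|nCy].
  rewrite sum_expand; first by rewrite /= addrC subrK.
  - exact: top_neq0.
  - by move: sumy; rewrite sum_lower (negbTE (top_none (carrier_simplex y) Cy)) add0r.
have -> : \sum_(v <- enum_fset (core y)) shrink (clamp u) (sval y) (Some v) =
   (1 - clamp u) * \sum_(v <- enum_fset (core y)) sval y (Some v).
  by rewrite mulr_sumr; apply: eq_bigr => v _; rewrite /shrink addr0.
have yN : sval y None = if None \in carrier y then sval y None else 0.
  by case: ifP => // /negbT/carrier_supp.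
rewrite /shrink yN; move: sumy; rewrite sum_lower.
set a := (if _ then _ else _); set b := \sum_(_ <- _) _ => ab.
have -> : b = 1 - a by rewrite -ab addrC addKr.
by ring.
Qed.

Lemma cone_deform_bary (y : X) u : barycentric Kc (cone_deform y u).
Proof.
have Ky := carrier_simplex y; set t := carrier y in Ky.
have supp s : (None |` t `<=` s)%fset -> Kc s -> barycentric Kc (cone_deform y u).
  move=> ts Ks; have ss : supported_in s (cone_deform y u).
    move=> o os; apply: cone_deform_supp; apply: contra os; exact: (fsubsetP ts).
  exists s; split => //; first exact: cone_deform_ge0.
  rewrite -(cone_deform_sum y u); apply: sum_supported2 => //; exact: cone_deform_supp.
have [Ly|Cy] := cone_alt Ky.
  apply: (supp (None |` t)%fset) => //; split; rewrite ?lower_none //; last by case: Ly.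
  by apply/fset0Pn; exists None; rewrite !inE eqxx.
have nt := top_none Ky Cy.
have dE : cone_deform y u = expand (lower t) (clamp u) (sval y).
  by rewrite /cone_deform asboolT.
have y0 := @realization_ge0 _ _ _ y; have y1 := @realization_le1 _ _ _ y.
have t0 := top_neq0 Cy; have u01 := clamp_itv u.
pose k := overshoot (lower t) (clamp u) (sval y).
have restrict s : Kc s -> supported_in s (cone_deform y u) -> barycentric Kc (cone_deform y u).
  move=> Ks ss; exists s; split => //; first exact: cone_deform_ge0.
  rewrite -(cone_deform_sum y u); apply: sum_supported2 => //; exact: cone_deform_supp.
have [k0|k0] : k = 0 \/ 0 < k.
  by have := overshoot_ge0 (lower t) (clamp u) (sval y); rewrite le_eqVlt -/k => /orP[/eqP<-|]; [left|right].
  apply: (restrict t) => // -[v|] ot; rewrite dE //=.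
  by rewrite in_lower (negbTE ot).
have [v vt v0] := expand_vanish t0 y1 k0.
apply: (restrict (None |` (t `\ Some v))%fset).
  have low : lower (None |` (t `\ Some v))%fset = (lower t `\ v)%fset.
    by apply/fsetP => w; rewrite in_lower in_fset1U !in_fsetD1 in_lower.
  have L : coned (lower t `\ v)%fset.
    apply: (top_facet C_top Cy); first exact: fsubD1set.
    apply: contraTneq vt => <-; by rewrite !inE eqxx.
  split; rewrite ?low //; last by case: L.
  by apply/fset0Pn; exists None; rewrite !inE eqxx.
move=> o; rewrite !inE negb_or negb_and negbK => /andP[oN /orP[/eqP->|ot]].
  by rewrite dE.
by apply: cone_deform_supp; rewrite !inE negb_or oN.
Qed.

Definition cone_map (p : X * R) : X := exist _ _ (cone_deform_bary p.1 p.2).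

Lemma cone_map_continuous : continuous cone_map.
Proof.
apply: (final_prod_continuous (@realization_final R _ Kc)) => -[s Ks'].
move: (svalP _) => Ks; change (simplices Kc s) in Ks; rewrite [sval _]/=.
pose y (p : closed_simplex R s * R) := sval (simplex_incl Ks p.1).
have cy o : continuous (fun p => y p o).
  exact: comp_continuous (@fst_continuous _ _) (@simplex_coord_continuous _ _ _ o).
have cu : continuous (fun p : closed_simplex R s * R => clamp p.2).
  exact: comp_continuous (@snd_continuous _ _) (@clamp_continuous R).
have sy (p : closed_simplex R s * R) : supported_in s (y p) by have [] := set_valP p.1.
apply: (@into_realization_continuous _ _ _ _ _ (None |` s)%fset) => [p o os|o] /=.
  apply: cone_deform_supp; apply: contra os; rewrite !inE => /orP[->//|oc].
  by rewrite (fsubsetP (carrier_sub (sy p))) ?orbT.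
have [Ls|Cs] := cone_alt Ks.
  have -> : (fun p : closed_simplex R s * R => cone_deform (simplex_incl Ks p.1) p.2 o) =
      fun p => shrink (clamp p.2) (y p) o.
    by apply/funext => p; rewrite cone_deform_coned; last exact: (cone_part_supp Ls (sy p)).
  exact: shrink_continuous.
have -> : (fun p : closed_simplex R s * R => cone_deform (simplex_incl Ks p.1) p.2 o) =
    fun p => expand (lower s) (clamp p.2) (y p) o.
  by apply/funext => p; rewrite (cone_deform_top _ Ks Cs (sy p)).
exact: expand_continuous.
Qed.

Lemma cone_map0 (y : X) : cone_map (y, 0) = y.
Proof.
apply: realization_eq => o; rewrite /= /cone_deform clamp0; case: asboolP => [Cy|_]; last first.
  by rewrite /shrink subr0 mul1r; case: o => [v|]; rewrite addr0.
rewrite expand0 //.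
- exact: top_neq0.
- by move=> ?; exact: realization_ge0.
- exact: core_out.
- by apply: carrier_supp; exact: top_none (carrier_simplex y) Cy.
Qed.

Lemma cone_map_part (y : X) u : cone_part y -> cone_part (cone_map (y, u)).
Proof.
move=> Ly; apply: (@cone_part_supp _ (None |` carrier y)%fset); first by rewrite lower_none.
exact: cone_deform_supp.
Qed.

Lemma cone_map1 (x y : X) : cone_part x -> cone_part y -> cone_map (x, 1) = cone_map (y, 1).
Proof.
move=> Lx Ly; apply: realization_eq => o /=.
by rewrite !cone_deform_coned // /shrink clamp1 subrr !mul0r.
Qed.

Lemma apex_bary : coned fset0 ->
  barycentric (R := R) Kc (fun o : option V => if o is None then 1 else 0).
Proof.
move=> L0; exists [fset None]%fset; split.
- have l0 : lower [fset None]%fset = fset0 :> {fset V}.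
    by apply/fsetP => v; rewrite in_lower !inE.
  split; rewrite ?l0 //; last by case: L0.
  by apply/fset0Pn; exists None; rewrite inE.
- by case=> [v|]; rewrite inE.
- by case.
- by rewrite big_seq_fset1.
Qed.

Lemma cone_contractible : coned fset0 -> (forall c, ~ C c) -> contractible R X.
Proof.
move=> L0 noC; have allA (y : X) : cone_part y.
  by have [//|/noC] := cone_alt (carrier_simplex y).
apply: (@quotient_homotopy_equivalent _ _ _ (fun=> tt : discrete_topology unit) cone_part cone_map).
- exact: cst_continuous.
- split=> [[]|U _]; last exact: discrete_open.
  by exists tt, (exist _ _ (apex_bary L0)).
- by move=> x y; split => // _; right; split.
- exact: cone_map_continuous.
- exact: cone_map0.
- exact: cone_map_part.
- exact: cone_map1.
Qed.

End ConeDeformationMap.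

(** * Stereographic projection of a simplex *)

Section Stereographic.
Context (R : realType) (m : nat).
Implicit Types (y : 'I_m.+1 -> R) (mu : R).
Local Notation q := (m.+1%:R : R).

Definition is_min y mu := (forall i, mu <= y i) /\ exists i, y i = mu.

Definition radius2 y : R := \sum_(i | i != ord0) (y i - q^-1) ^+ 2.

(** For the minimum [mu] of the barycentric coordinates [y], the vector
    with entries [(y i - q^-1) / mu] runs once through the hyperplane of sum
    zero as [y] runs through the interior of the simplex.  Forgetting its
    first entry identifies this hyperplane with the space onto which the
    sphere without its base point is projected stereographically from that
    point.  Clearing denominators extends the resulting map to the boundary,
    where [mu = 0], and sends it to the base point. *)
Definition stereo y mu : 'rV[R]_m.+1 :=
  \row_i ((if i == ord0 then radius2 y - mu ^+ 2 else 2 * mu * (y i - q^-1))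
          / (radius2 y + mu ^+ 2)).

Lemma radius2_ge0 y : 0 <= radius2 y.
Proof. by apply: sumr_ge0 => i _; exact: sqr_ge0. Qed.

Lemma sum_centered y : \sum_i y i = 1 -> \sum_i (y i - q^-1) = 0.
Proof.
move=> y1; rewrite big_split /= y1 sumrN sumr_const card_ord -[_ *+ _]mulr_natr.
by rewrite mulVf ?subrr // pnatr_eq0.
Qed.

Lemma centered0 y : \sum_i y i = 1 ->
  y ord0 - q^-1 = - \sum_(i | i != ord0) (y i - q^-1).
Proof.
by move=> /sum_centered; rewrite (bigD1 ord0) //= => /eqP; rewrite addr_eq0 => /eqP.
Qed.

(** If [mu] and the radius vanish, then [y] is both on the boundary and
    equal to the barycentre. *)
Lemma stereo_den y mu : \sum_i y i = 1 -> 0 <= mu -> is_min y mu ->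
  0 < radius2 y + mu ^+ 2.
Proof.
move=> y1 mu0 [_ [i0 yi0]]; rewrite lt_neqAle addr_ge0 ?radius2_ge0 ?sqr_ge0 // andbT eq_sym.
rewrite paddr_eq0 ?radius2_ge0 ?sqr_ge0 // sqrf_eq0; apply/negP => /andP[Z0 /eqP m0].
have yi i : i != ord0 -> y i - q^-1 = 0.
  move=> i0'; apply/eqP; rewrite -sqrf_eq0; apply/eqP.
  move: Z0; rewrite /radius2 psumr_eq0 => [/allP/(_ i)|j _]; last exact: sqr_ge0.
  by rewrite mem_index_enum i0' => /(_ isT)/eqP.
have y0 : y i0 - q^-1 = 0.
  have [->|] := eqVneq i0 ord0; last exact: yi.
  by rewrite centered0 // big1 ?oppr0.
move: y0; rewrite yi0 m0 sub0r => /eqP; rewrite oppr_eq0 invr_eq0 pnatr_eq0.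
by [].
Qed.

Lemma stereo_sphere y mu : 0 < radius2 y + mu ^+ 2 -> stereo y mu \in @sphere R m.
Proof.
move=> D0; rewrite inE /sphere /= (bigD1 ord0) //= mxE eqxx.
rewrite (eq_bigr (fun i => (2 * mu / (radius2 y + mu ^+ 2)) ^+ 2 * (y i - q^-1) ^+ 2)); last first.
  by move=> i i0; rewrite mxE (negbTE i0) -exprMn; congr (_ ^+ 2); ring.
rewrite -mulr_sumr -/(radius2 y).
by field; rewrite gt_eqF.
Qed.

Lemma stereo_base y mu : 0 < radius2 y + mu ^+ 2 -> mu = 0 ->
  stereo y mu = delta_mx ord0 ord0.
Proof.
move=> + mu0; rewrite mu0 expr0n addr0 => D0; apply/rowP => i; rewrite !mxE eqxx /=.
rewrite expr0n subr0 addr0; case: eqVneq => _; last by rewrite mulr0 mul0r mul0r.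
by rewrite divff ?gt_eqF.
Qed.

Lemma stereo_neq_base y mu : 0 < radius2 y + mu ^+ 2 -> mu != 0 ->
  stereo y mu <> delta_mx ord0 ord0.
Proof.
move=> D0 mu0 /rowP/(_ ord0); rewrite !mxE eqxx /= => /(congr1 (fun x => x * (radius2 y + mu ^+ 2))).
rewrite divfK ?gt_eqF // mul1r => /eqP; rewrite -subr_eq0.
rewrite (_ : _ - _ = - (2 * mu ^+ 2)); last by ring.
by rewrite oppr_eq0 mulf_eq0 pnatr_eq0 /= sqrf_eq0 (negbTE mu0).
Qed.

(** The projection determines the direction of [y] from the barycentre
    in units of [mu]; the scale is then fixed by [mu] being the minimum. *)
Lemma stereo_inj y y' mu mu' :
  \sum_i y i = 1 -> \sum_i y' i = 1 -> is_min y mu -> is_min y' mu' ->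
  0 < mu -> 0 < mu' -> stereo y mu = stereo y' mu' -> y =1 y'.
Proof.
move=> y1 y1' ym ym' mu0 mu0' E.
have D0 := stereo_den y1 (ltW mu0) ym; have D0' := stereo_den y1' (ltW mu0') ym'.
set D := _ + _ in D0; set D' := _ + _ in D0'.
have E0 : mu ^+ 2 / D = mu' ^+ 2 / D'.
  move/rowP/(_ ord0): E; rewrite !mxE eqxx -/D -/D' => E.
  have -> : mu ^+ 2 / D = (1 - (radius2 y - mu ^+ 2) / D) / 2.
    by rewrite /D; field; rewrite gt_eqF.
  by rewrite E /D'; field; rewrite gt_eqF.
have Ei i : i != ord0 -> (y i - q^-1) / mu = (y' i - q^-1) / mu'.
  move=> i0; move/rowP/(_ i): E; rewrite !mxE (negbTE i0) -/D -/D' => E.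
  have r0 : mu ^+ 2 / D != 0 by rewrite gt_eqF // divr_gt0 // exprn_gt0.
  apply: (mulfI r0); rewrite {2}E0.
  have -> : mu ^+ 2 / D * ((y i - q^-1) / mu) = (2 * mu * (y i - q^-1) / D) / 2.
    by field; rewrite !gt_eqF.
  by rewrite E; field; rewrite !gt_eqF.
have Eall i : (y i - q^-1) / mu = (y' i - q^-1) / mu'.
  have [->|] := eqVneq i ord0; last exact: Ei.
  rewrite !centered0 // !mulNr !mulr_suml; congr (- _); apply: eq_bigr => j; exact: Ei.
have q0 : 0 < q^-1 :> R by rewrite invr_gt0 ltr0n.
have cmp (z z' : 'I_m.+1 -> R) (a a' : R) : 0 < a -> 0 < a' -> is_min z a -> is_min z' a' ->
    (forall i, (z i - q^-1) / a = (z' i - q^-1) / a') -> a' <= a.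
  move=> a0 a0' [_ [i zi]] [z'm _] Ez.
  have := z'm i; have -> : z' i = (z i - q^-1) / a * a' + q^-1.
    by rewrite Ez divfK ?gt_eqF // subrK.
  rewrite zi; have -> : (a - q^-1) / a * a' + q^-1 = a' + q^-1 * (1 - a' / a).
    by field; rewrite !gt_eqF // ltr0n.
  by rewrite lerDl pmulr_rge0 // subr_ge0 ler_pdivrMr // mul1r.
have mm : mu = mu'.
  apply/eqP; rewrite eq_le; apply/andP; split; last exact: (cmp y y').
  by apply: (cmp y' y).
move=> i; have := Eall i; rewrite mm => /(congr1 (fun x => x * mu')).
by rewrite !divfK ?gt_eqF // => /addIr.
Qed.

(** The direction of the preimage is read off the stereographic projection
    of [x]; its scale [l] is the one for which the minimum is [l * s]. *)
Lemma stereo_surj (x : 'rV[R]_m.+1) : \sum_i x ord0 i ^+ 2 = 1 -> x != delta_mx ord0 ord0 ->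
  exists y mu, [/\ \sum_i y i = 1, 0 < mu, is_min y mu & stereo y mu = x].
Proof.
move=> x1 xb; pose s := 1 - x ord0 ord0.
(* The missing first entry is restored so that the sum vanishes. *)
pose w i := if i == ord0 then - \sum_(j | j != ord0) x ord0 j else x ord0 i.
have w0 : \sum_i w i = 0.
  rewrite (bigD1 ord0) //= {1}/w eqxx (eq_bigr (x ord0)) ?addNr // => i i0.
  by rewrite /w (negbTE i0).
have sq_rest : \sum_(i | i != ord0) x ord0 i ^+ 2 = s * (2 - s).
  move: x1; rewrite (bigD1 ord0) //= => /(canRL (addKr _)) ->; rewrite /s; ring.
have s0 : 0 < s.
  have rest0 : 0 <= \sum_(i | i != ord0) x ord0 i ^+ 2.
    by apply: sumr_ge0 => i _; exact: sqr_ge0.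
  have x01 : x ord0 ord0 <= 1.
    have : x ord0 ord0 ^+ 2 <= 1 by rewrite -x1 (bigD1 ord0) //= lerDl.
    rewrite -subr_ge0 => ?; nra.
  rewrite lt_neqAle subr_ge0 x01 andbT; apply: contra xb => /eqP sE.
  apply/eqP/rowP => i; rewrite mxE eqxx /=.
  have [->|i0] := eqVneq i ord0.
    by apply/eqP; rewrite eq_sym -subr_eq0 -/s -sE.
  apply/eqP; rewrite -sqrf_eq0; move: sq_rest; rewrite -sE mul0r => /eqP.
  rewrite psumr_eq0 => [/allP/(_ i)|j _]; last exact: sqr_ge0.
  by rewrite mem_index_enum i0 => /(_ isT).
pose i1 := [arg min_(i < ord0) w i]%O.
have wmin i : w i1 <= w i.
  by rewrite /i1; case: arg_minP => // j _; apply.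
have wi1 : w i1 <= 0.
  rewrite leNgt; apply/negP => wpos; have : 0 < \sum_i w i.
    rewrite (bigD1 ord0) //= ltr_pwDl //; first exact: lt_le_trans (wmin _).
    by apply: sumr_ge0 => i _; apply: ltW; exact: lt_le_trans (wmin _).
  by rewrite w0 ltxx.
have q0 : 0 < q :> R by rewrite ltr0n.
pose l := (q * (s - w i1))^-1.
have sw : 0 < s - w i1 by rewrite subr_gt0 (le_lt_trans wi1).
have l0 : 0 < l by rewrite invr_gt0 mulr_gt0.
pose y i := q^-1 + l * w i.
have lsE : q^-1 + l * w i1 = l * s.
  rewrite /l; field; by rewrite !gt_eqF // subr_gt0 (le_lt_trans wi1).
have yw i : i != ord0 -> y i - q^-1 = l * x ord0 i.
  by move=> i0; rewrite /y addrC addKr /w (negbTE i0).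
have rE : radius2 y = l ^+ 2 * (s * (2 - s)).
  rewrite -sq_rest mulr_sumr; apply: eq_bigr => i i0.
  by rewrite yw // exprMn.
exists y, (l * s); split.
- rewrite big_split /= -mulr_sumr w0 mulr0 addr0 sumr_const card_ord -[_ *+ _]mulr_natr.
  by rewrite mulVf // gt_eqF.
- exact: mulr_gt0.
- split=> [i|]; last by exists i1.
  by rewrite -lsE lerD2l ler_pM2l.
- have DE : l ^+ 2 * (s * (2 - s)) + (l * s) ^+ 2 = 2 * l ^+ 2 * s by ring.
  apply/rowP => i; rewrite mxE rE DE.
  case: eqVneq => [->|i0].
    have -> : x ord0 ord0 = 1 - s by rewrite /s; ring.
    by field; rewrite !gt_eqF.
  by rewrite yw //; field; rewrite !gt_eqF.
Qed.

End Stereographic.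

(** * From the cone to the wedge of spheres *)

Lemma rV_continuous (R : realType) (Z : topologicalType) (n : nat) (f : Z -> 'rV[R]_n) :
  (forall i, continuous (fun z => f z ord0 i)) -> continuous f.
Proof.
move=> cf z A [P fP PA].
have : nbhs z [set z' | forall i, P ord0 i (f z' ord0 i)].
  by apply: filter_forall => i; apply: cf; exact: fP.
apply: filterS => z' Pz; apply: PA => i j.
by rewrite (ord1 i); exact: Pz.
Qed.

Lemma continuous_sum (R : realType) (Z : topologicalType) (I : Type) (r : seq I)
    (p : pred I) (f : I -> Z -> R) :
  (forall i, continuous (f i)) -> continuous (fun z => \sum_(i <- r | p i) f i z).
Proof.
move=> cf; elim: r => [|i r IH].
  by under eq_fun do rewrite big_nil; exact: cst_continuous.
under eq_fun do rewrite big_cons; case: (p i) => //; exact: continuousD.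
Qed.

Lemma set_type_continuous (X Z : topologicalType) (A : set X) (f : Z -> A) :
  continuous (fun z => set_val (f z)) -> continuous f.
Proof.
move=> cf; apply/continuousP => _ [B oB <-].
by move/continuousP: cf => /(_ B oB).
Qed.

Lemma set_type_hausdorff (X : topologicalType) (A : set X) :
  hausdorff_space X -> hausdorff_space A.
Proof.
move=> hX x y xy; apply: val_inj; apply: hX => U V xU yV.
have [z [Uz Vz]] := xy _ _ (@initial_continuous A X set_val x _ xU)
  (@initial_continuous A X set_val y _ yV).
by exists (set_val z).
Qed.

(** A cluster point of the image filter lies in [A] and is a cluster point
    in the subtype. *)
Lemma set_type_compact (X : topologicalType) (A : set X) :
  compact A -> compact [set: A].
Proof.
move=> cA F PF _.
have [x [Ax xF]] := cA (set_val @ F) _ (filterS (fun z _ => set_valP z) filterT).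
exists (SigSub (mem_set Ax)); split => // B U FB [_ [[W oW <-] /= Wx WU]].
have [|z [[b Bb bz] Wz]] := xF (set_val @` B) W _ (open_nbhs_nbhs (conj oW Wx)).
  by apply: (@filterS _ F _ B) => // b Bb; exists b.
by exists b; split => //; apply: WU; rewrite /= bz.
Qed.

Lemma closed_simplex_compact (R : realType) (V : choiceType) (s : {fset V}) :
  compact (closed_simplex R s).
Proof.
pose A (v : V) : set R := if v \in s then `[0, 1]%classic else [set 0].
have -> : closed_simplex R s = [set x : {ptws V -> R} | forall v, A v (x v)] `&`
    [set x : {ptws V -> R} | \sum_(v <- enum_fset s) x v = 1].
  apply/seteqP; split=> [x [sx x0 x1]|x [Ax x1]] /=; split => //.
  - move=> v; rewrite /A; case: ifP => [vs|/negbT/sx //].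
    rewrite /= in_itv /= x0 -x1 (big_fsetD1 v vs) /= lerDl.
    by apply: sumr_ge0.
  - by move=> v vs; have := Ax v; rewrite /A (negbTE vs).
  - move=> v; have := Ax v; rewrite /A; case: ifP => _ /=.
      by rewrite in_itv /= => /andP[].
    by move=> ->.
apply: compact_closedI.
  apply: tychonoff => v; rewrite /A; case: ifP => _; last exact: compact_set1.
  exact: segment_compact.
have csum : continuous (fun x : {ptws V -> R} => \sum_(v <- enum_fset s) x v).
  by apply: continuous_sum => v; exact: proj_continuous.
by move/continuous_closedP: csum => /(_ [set 1] (@closed_eq R 1)).
Qed.

Section ConeToWedge.
Context (R : realType) (V : choiceType) (K : simplicialComplex V) (C : set {fset V}).
Context (m : nat).
Hypothesis K_size : forall c, K c -> (#|` c| <= m.+1)%N.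
Hypothesis C_top : forall c, C c -> K c /\ #|` c| = m.+1.
Context (v0 : V).
Implicit Types (c d : {fset V}) (t s : {fset option V}).

Local Notation Kc := (cone K_size C_top).
Local Notation X := (realization R Kc).
Local Notation coned := (coned K C).
Local Notation core y := (lower (carrier y)).
Local Notation I := {c : {fset V} | `[< C c >]}.
Local Notation sph := (set_type (@sphere R m)).

Hypothesis coned0 : coned fset0.
Context (i0 : I).

Definition coords c (y : option V -> R) (i : 'I_m.+1) : R :=
  y (Some (nth v0 (enum_fset c) i)).

Definition sphere_coords c (y : option V -> R) : 'rV[R]_m.+1 :=
  stereo (coords c y) (mincoord c (y \o Some)).

Definition to_sphere (x : 'rV[R]_m.+1) : sph := insubd (sphere_base R m) x.

Lemma to_sphereK x : x \in @sphere R m -> set_val (to_sphere x) = x.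
Proof. by move=> xS; rewrite /to_sphere set_valE val_insubd xS. Qed.

Lemma to_sphere_base : to_sphere (delta_mx ord0 ord0) = sphere_base R m.
Proof. by apply: val_inj; exact: (to_sphereK (sphere_base_subproof R m)). Qed.

Lemma sum_coords c y : #|` c| = m.+1 ->
  \sum_i coords c y i = \sum_(v <- enum_fset c) y (Some v).
Proof. by move=> cm; rewrite (big_nth v0) cm big_mkord. Qed.

Lemma is_min_coords c (y : option V -> R) : #|` c| = m.+1 -> (forall o, y o <= 1) ->
  is_min (coords c y) (mincoord c (y \o Some)).
Proof.
move=> cm y1; split=> [i|].
  by apply: (mincoord_le (y \o Some)); rewrite -[_ \in _]/(_ \in enum_fset c) mem_nth // cm.
have c0 : c != fset0 by rewrite -cardfs_eq0 cm.
have [v vc yv] := @mincoord_attained _ _ c (y \o Some) c0 (fun w _ => y1 _).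
have vi : (index v (enum_fset c) < m.+1)%N by rewrite -cm index_mem.
by exists (Ordinal vi); rewrite -yv /coords /= nth_index.
Qed.

Definition idx c (Cc : C c) : I := exist _ c (asboolT Cc).

Definition lift (i : I) (x : sph) : wedge_of_spheres R I m :=
  @wedge_lift I (fun=> sph) (fun=> sphere_base R m) i x.

Lemma lift_continuous i : continuous (lift i).
Proof. exact: (@wedge_lift_continuous I (fun=> sph) (fun=> sphere_base R m) i). Qed.

Lemma lift_base i j : lift i (sphere_base R m) = lift j (sphere_base R m).
Proof.
exact: (@wedge_liftE I (fun=> sph) (fun=> sphere_base R m) j (sphere_base R m)
  i (sphere_base R m)).
Qed.

(** The only identification in a wedge is that of the base points. *)
Lemma lift_inj i j x y : lift i x = lift j y ->
  (i = j /\ x = y) \/ (x = sphere_base R m /\ y = sphere_base R m).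
Proof.
move=> /eqmodP/predU1P[E|/andP[/eqP/= -> /eqP/= ->]]; last by right.
left; split; first by have := congr1 (@projT1 _ _) E.
exact: (congr1 (fun p : {i : I & sph} => projT2 p) E).
Qed.

(** The index of the summand is the core of [y], so the base point of the
    summand [i0] stands for the whole coned part. *)
Definition wedge_map (y : X) : wedge_of_spheres R I m :=
  match pselect (C (core y)) with
  | left Cy => lift (idx Cy) (to_sphere (sphere_coords (core y) (sval y)))
  | right _ => lift i0 (sphere_base R m)
  end.

Lemma top_sum (y : X) s : Kc s -> C (lower s) -> supported_in s (sval y) ->
  \sum_(v <- enum_fset (lower s)) sval y (Some v) = 1.
Proof.
move=> Ks Cs sy; rewrite -(realization_sum sy) sum_lower.
by rewrite (negbTE (top_none Ks Cs)) add0r.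
Qed.

Lemma mincoord_realization (y : X) c : 0 <= mincoord c (sval y \o Some).
Proof. by apply: mincoord_ge => // v _; exact: realization_ge0. Qed.

Lemma sphere_coords_den (y : X) s : Kc s -> C (lower s) -> supported_in s (sval y) ->
  0 < radius2 (coords (lower s) (sval y)) + mincoord (lower s) (sval y \o Some) ^+ 2.
Proof.
move=> Ks Cs sy; have [_ sm] := C_top Cs; apply: stereo_den.
- by rewrite sum_coords // (top_sum Ks).
- exact: mincoord_realization.
- by apply: is_min_coords => //; exact: realization_le1.
Qed.

Lemma wedge_map_coned (y : X) : cone_part y -> wedge_map y = lift i0 (sphere_base R m).
Proof. by rewrite /wedge_map; case: pselect => // Cy [_]. Qed.

(** On the boundary of a simplex of [C] the projection is the base point,
    so the formula holds on the closed simplex. *)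
Lemma wedge_map_top (y : X) s (Cs : C (lower s)) : Kc s -> supported_in s (sval y) ->
  wedge_map y = lift (idx Cs) (to_sphere (sphere_coords (lower s) (sval y))).
Proof.
move=> Ks sy; rewrite /wedge_map; case: pselect => [Cy|nCy].
  have E : core y = lower s.
    apply/eqP; rewrite eqEfcard core_sub //=.
    by have [_ ->] := C_top Cs; have [_ ->] := C_top Cy.
  move: Cy; rewrite E => Cy; congr (lift (idx _) _); exact: Prop_irrelevance.
rewrite /sphere_coords stereo_base ?to_sphere_base; first exact: lift_base.
  exact: sphere_coords_den.
have [v vs vy] : exists2 v, v \in lower s & v \notin core y.
  apply/fsubsetPn/negP => sy'; apply: nCy; suff -> : core y = lower s by [].
  by apply/eqP; rewrite eqEfsubset sy' core_sub.
apply/eqP; rewrite eq_le mincoord_realization andbT.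
by rewrite -(core_out vy); exact: (mincoord_le (sval y \o Some)).
Qed.

Lemma mincoord_core (y : X) : C (core y) -> 0 < mincoord (core y) (sval y \o Some).
Proof.
move=> Cy; have [v vc <-] := @mincoord_attained _ _ (core y) (sval y \o Some)
  (top_neq0 C_top Cy) (fun w _ => realization_le1 _ _).
rewrite lt_neqAle realization_ge0 andbT eq_sym /=.
by apply: carrier_neq0; rewrite -in_lower.
Qed.

Lemma wedge_map_fibers (x y : X) :
  wedge_map x = wedge_map y <-> x = y \/ (cone_part x /\ cone_part y).
Proof.
have Kx := carrier_simplex x; have Ky := carrier_simplex y.
have sx := @carrier_supp _ _ _ x; have sy := @carrier_supp _ _ _ y.
have pb (z : X) : C (core z) -> to_sphere (sphere_coords (core z) (sval z)) <> sphere_base R m.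
  move=> Cz; have D0 := sphere_coords_den (carrier_simplex z) Cz (@carrier_supp _ _ _ z).
  move/(congr1 set_val); rewrite to_sphereK; last exact: stereo_sphere.
  by apply: stereo_neq_base => //; rewrite gt_eqF // mincoord_core.
split; last by case=> [->//|[Lx Ly]]; rewrite !wedge_map_coned.
have [Lx|Cx] := cone_alt Kx; have [Ly|Cy] := cone_alt Ky.
- by move=> _; right.
- rewrite (wedge_map_coned Lx) (wedge_map_top Cy Ky sy) => /lift_inj[[_ /esym/pb []//]|[_ /pb []//]].
- rewrite (wedge_map_coned Ly) (wedge_map_top Cx Kx sx) => /lift_inj[[_ /pb []//]|[/pb []//]].
rewrite (wedge_map_top Cx Kx sx) (wedge_map_top Cy Ky sy).
move=> /lift_inj[[/(congr1 val)/= cE pE]|[/pb []//]]; left.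
have [_ cm] := C_top Cy.
have Dx := sphere_coords_den Kx Cx sx; have Dy := sphere_coords_den Ky Cy sy.
move/(congr1 set_val): pE; rewrite !to_sphereK; try exact: stereo_sphere.
move=> pE.
have E : coords (core x) (sval x) =1 coords (core y) (sval y).
  apply: (stereo_inj _ _ _ _ _ _ pE).
  - by rewrite sum_coords ?cE // -cE (top_sum Kx).
  - by rewrite sum_coords // (top_sum Ky).
  - by apply: is_min_coords; rewrite ?cE //; exact: realization_le1.
  - by apply: is_min_coords => //; exact: realization_le1.
  - exact: mincoord_core.
  - exact: mincoord_core.
apply: realization_eq => -[v|]; last by rewrite sx ?sy // ?(top_none Kx) // (top_none Ky).
case: (boolP (v \in core y)) => vy; last by rewrite (core_out vy) core_out // cE.
have vi : (index v (enum_fset (core y)) < m.+1)%N.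
  by apply: leq_trans (eq_leq cm); rewrite index_mem.
by have := E (Ordinal vi); rewrite /coords cE /= nth_index.
Qed.

Lemma wedge_map_surj z : exists y : X, wedge_map y = z.
Proof.
pose apex : X := exist _ _ (apex_bary R K_size C_top coned0).
have Lapex : cone_part apex.
  apply: (@cone_part_supp _ _ _ _ _ _ _ _ [fset None]%fset); last by case=> [v|]; rewrite inE.
  suff -> : lower [fset None]%fset = fset0 :> {fset V} by [].
  by apply/fsetP => v; rewrite in_lower !inE.
have : (\bigcup_i (lift i) @` setT) z by rewrite wedgeTE.
case=> i _ [x _ <-].
have [->|xb] := eqVneq x (sphere_base R m).
  by exists apex; rewrite wedge_map_coned //; exact: lift_base.
have [] := @stereo_surj R m (set_val x).
- exact: (set_valP x).
- by apply: contra xb => /eqP xE; apply/eqP/val_inj; rewrite /= -set_valE xE.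
move=> y [mu [y1 mu0 ymin yx]].
case: i => c Cc; have {}Cc' : C c by exact/asboolP.
have [Kcc cm] := C_top Cc'.
pose f (o : option V) : R :=
  if o is Some v then if v \in c then y (inord (index v (enum_fset c))) else 0 else 0.
have fc : coords c f =1 y.
  move=> i; rewrite /coords /f -[_ \in _]/(_ \in enum_fset c) mem_nth ?cm //.
  by rewrite index_uniq ?fset_uniq ?cm // inord_val.
have f0 o : 0 <= f o.
  case: o => [v|] //=; case: ifP => // _; apply: le_trans (ymin.1 _); exact: ltW.
have Kr : Kc (raise c).
  split; rewrite ?raiseK ?none_in_raise //; last by right.
  exact: base_neq0 (raise_base Kcc).
have fb : barycentric Kc f.
  exists (raise c); split => //.
    by case=> [v|] //=; rewrite some_in_raise => /negbTE ->.
  rewrite sum_lower none_in_raise add0r raiseK -sum_coords // -y1.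
  by apply: eq_bigr => i _; exact: fc.
pose p : X := exist _ f fb.
have sp : supported_in (raise c) (sval p).
  by case=> [v|] //=; rewrite some_in_raise => /negbTE ->.
have Cr : C (lower (raise c)) by rewrite raiseK.
have fmin : is_min (coords c f) (mincoord c (f \o Some)).
  by apply: is_min_coords => // o; exact: (realization_le1 p).
have fE : coords c f = y by apply/funext.
have muE : mincoord c (f \o Some) = mu.
  move: fmin; rewrite fE => -[lb [i yi]]; have [lb' [j yj]] := ymin.
  by apply/eqP; rewrite eq_le -{1}yj lb -yi lb'.
exists p; rewrite (wedge_map_top Cr Kr sp).
have -> : idx Cr = exist _ c Cc by apply: val_inj => /=; rewrite raiseK.
congr (lift _ _); apply: val_inj.
rewrite raiseK /sphere_coords fE muE yx -!set_valE to_sphereK //; exact/mem_set/(set_valP x).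
Qed.

Definition top_map s (Ks : Kc s) (p : closed_simplex R s) : sph :=
  to_sphere (sphere_coords (lower s) (sval (simplex_incl Ks p))).

Lemma top_map_continuous s (Ks : Kc s) : C (lower s) -> continuous (top_map Ks).
Proof.
move=> Cs; have sy (p : closed_simplex R s) : supported_in s (sval (simplex_incl Ks p)).
  by have [] := set_valP p.
apply: set_type_continuous.
have -> : (fun p : closed_simplex R s => set_val (top_map Ks p)) =
    fun p => sphere_coords (lower s) (sval (simplex_incl Ks p)).
  apply/funext => p; rewrite /top_map to_sphereK //; apply: stereo_sphere.
  exact: (sphere_coords_den Ks Cs (sy p)).
have cy o : continuous (fun p : closed_simplex R s => sval (simplex_incl Ks p) o).
  exact: simplex_coord_continuous.
have cm : continuous (fun p : closed_simplex R s =>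
    mincoord (lower s) (sval (simplex_incl Ks p) \o Some)).
  by apply: continuous_mincoord => v; exact: cy.
have cst := @continuous_cst R (closed_simplex R s).
have cr : continuous (fun p : closed_simplex R s =>
    radius2 (coords (lower s) (sval (simplex_incl Ks p)))).
  apply: continuous_sum => i.
  by apply: continuousM; apply: continuousB => //; exact: cy.
apply: rV_continuous => i.
have -> : (fun p : closed_simplex R s => sphere_coords (lower s) (sval (simplex_incl Ks p)) ord0 i) =
  fun p => (if i == ord0 then radius2 (coords (lower s) (sval (simplex_incl Ks p)))
       - mincoord (lower s) (sval (simplex_incl Ks p) \o Some) ^+ 2
     else 2 * mincoord (lower s) (sval (simplex_incl Ks p) \o Some) *
       (coords (lower s) (sval (simplex_incl Ks p)) i - m.+1%:R^-1)) /
    (radius2 (coords (lower s) (sval (simplex_incl Ks p))) +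
      mincoord (lower s) (sval (simplex_incl Ks p) \o Some) ^+ 2).
  by apply/funext => p; rewrite mxE.
apply: continuousM.
  case: (i == ord0); first by apply: continuousB => //; exact: continuousM.
  apply: continuousM; first exact: continuousM.
  by apply: continuousB => //; exact: cy.
apply: continuousV => [p|].
  by rewrite gt_eqF // (sphere_coords_den Ks Cs (sy p)).
by apply: continuousD => //; exact: continuousM.
Qed.

Lemma wedge_map_continuous : continuous wedge_map.
Proof.
apply: (final_continuous (@realization_final R _ Kc)) => -[s Ks'].
move: (svalP _) => Ks; change (simplices Kc s) in Ks; rewrite [sval _]/=.
have sy (p : closed_simplex R s) : supported_in s (sval (simplex_incl Ks p)).
  by have [] := set_valP p.
have [Ls|Cs] := cone_alt Ks.
  have -> : wedge_map \o simplex_incl Ks = fun=> lift i0 (sphere_base R m).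
    by apply/funext => p /=; apply: wedge_map_coned; exact: (cone_part_supp Ls (sy p)).
  exact: cst_continuous.
have -> : wedge_map \o simplex_incl Ks = fun p : closed_simplex R s =>
    lift (idx Cs) (to_sphere (sphere_coords (lower s) (sval (simplex_incl Ks p)))).
  by apply/funext => p /=; rewrite (wedge_map_top Cs Ks (sy p)).
exact: comp_continuous (top_map_continuous (Ks := Ks) Cs) (@lift_continuous (idx Cs)).
Qed.

(** A closed simplex is compact and the sphere is Hausdorff, so closed
    sets of the simplex have closed images.  The base point is added
    separately: it is not in the image when the simplex is a single vertex. *)
Lemma wedge_map_final : final_family (fun _ : unit => wedge_map).
Proof.
split=> [z|U /(_ tt) oU]; first by have [y yz] := wedge_map_surj z; exists tt, y.
apply/(@wedge_openP I (fun=> sph) (fun=> sphere_base R m)) => -[c Cc'].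
have Cc : C c by exact/asboolP.
have [Kcc cm] := C_top Cc.
have Kr : Kc (raise c).
  split; rewrite ?raiseK ?none_in_raise //; last by right.
  exact: base_neq0 (raise_base Kcc).
have Cr : C (lower (raise c)) by rewrite raiseK.
have sy (p : closed_simplex R (raise c)) : supported_in (raise c) (sval (simplex_incl Kr p)).
  by have [] := set_valP p.
have -> : exist _ c Cc' = idx Cr :> I by apply: val_inj; rewrite /= raiseK.
set U' : set sph := lift (idx Cr) @^-1` U; rewrite -[X in open X]/U' -closedC.
have hS : hausdorff_space sph := set_type_hausdorff (@norm_hausdorff _ _).
pose phi := top_map Kr.
have wphi p : lift (idx Cr) (phi p) = wedge_map (simplex_incl Kr p).
  by rewrite (wedge_map_top Cr Kr (sy p)).
(* Every point other than the base point has a preimage in the simplex. *)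
have -> : ~` U' = phi @` (phi @^-1` (~` U')) `|` ((~` U') `&` [set sphere_base R m]).
  apply/seteqP; split=> [x nUx|x [[p nUp <-]|[]] //].
  have [xE|/eqP xb] := eqVneq x (sphere_base R m); first by right.
  left; have [y yx] := wedge_map_surj (lift (idx Cr) x).
  have [Ly|Cy] := cone_alt (carrier_simplex y).
    by move: yx; rewrite (wedge_map_coned Ly) => /lift_inj[[_ /esym]|[_]].
  move: (yx); rewrite (wedge_map_top Cy (carrier_simplex y) (@carrier_supp _ _ _ y)).
  move=> /lift_inj[[/(congr1 val)/= cE _]|[_ //]].
  have sry : supported_in (raise c) (sval y).
    have -> : raise c = carrier y.
      by rewrite -(lowerK (top_none (carrier_simplex y) Cy)) cE raiseK.
    exact: carrier_supp.
  have ysimp : closed_simplex R (raise c) (sval y).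
    by split => //; [move=> o; exact: realization_ge0|exact: realization_sum].
  pose p : closed_simplex R (raise c) := SigSub (mem_set ysimp).
  have yp : y = simplex_incl Kr p by exact: realization_eq.
  have phix : phi p = x.
    by move: yx; rewrite yp -wphi => /lift_inj[[_ ->]|[_]].
  by exists p => //=; rewrite phix.
apply: closedU.
  apply: (compact_closed hS).
  apply: continuous_compact.
    exact/continuous_subspaceT/(top_map_continuous (Ks := Kr) Cr).
  rewrite -[X in compact X]setTI; apply: compact_closedI.
    exact: set_type_compact (@closed_simplex_compact R _ (raise c)).
  have -> : phi @^-1` (~` U') = simplex_incl Kr @^-1` (wedge_map @^-1` (~` U)).
    by apply/seteqP; split => p /=; rewrite /U' /= wphi.
  move/continuous_closedP: (@simplex_incl_continuous R _ _ _ Kr); apply.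
  by rewrite preimage_setC closedC.
have [nb|/contrapT b] := pselect ((~` U') (sphere_base R m)).
  rewrite setIidr; last by move=> _ ->.
  exact: accessible_closed_set1 (hausdorff_accessible hS) _.
rewrite (_ : _ `&` _ = set0); first exact: closed0.
by apply/seteqP; split=> x // -[nx xE]; apply: nx; rewrite xE.
Qed.

Lemma cone_wedge_equivalent : homotopy_equivalent R X (wedge_of_spheres R I m).
Proof.
apply: (quotient_homotopy_equivalent wedge_map_continuous wedge_map_final wedge_map_fibers
  (@cone_map_continuous R V K C m.+1 K_size C_top)).
- exact: cone_map0.
- exact: cone_map_part.
- exact: cone_map1.
Qed.
End ConeToWedge.

(** * Matchings on the chains of a poset *)

Section Chains.
Context (disp : Order.disp_t) (P : porderType disp).
Implicit Types (Q : set P) (c d : {fset P}) (S : {pred P}).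

Definition chains_in Q : set {fset P} :=
  [set c : {fset P} | (forall x, x \in c -> Q x) /\ {in c &, forall x y, (x >=< y)%O}].

Lemma chains_inS Q c d : (d `<=` c)%fset -> chains_in Q c -> chains_in Q d.
Proof.
move=> /fsubsetP dc [cQ cc]; split => [x /dc/cQ//|x y /dc xc /dc yc]; exact: cc.
Qed.

(** The combinatorial form of being spherical of dimension [e - 1]: all
    chains, the empty one included, are matched except those in a set [C] of
    chains of maximal size.  The rank bound [N] is recorded because the
    attaching argument matches infinitely many links at once. *)
Definition spherical_poset Q (e N : nat) : Prop :=
  [/\ forall c, chains_in Q c -> (#|` c| <= e)%N,
      exists2 c, chains_in Q c & #|` c| = e &
      exists C : set {fset P}, (forall c, C c -> chains_in Q c /\ #|` c| = e) /\
        perfect_matching [set c | chains_in Q c /\ ~ C c] N].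

Lemma restr_cat S c : (restr S c `|` restr [predC S] c)%fset = c.
Proof.
by apply/fsetP => x; rewrite in_fsetU !in_restr !inE -andb_orr orbN andbT.
Qed.

Lemma card_restr_cat S c : (#|` restr S c| + #|` restr [predC S] c|)%N = #|` c|.
Proof.
rewrite -[in RHS](restr_cat S c) cardfsU [X in (_ - #|` X|)%N](_ : _ = fset0).
  by rewrite cardfs0 subn0.
apply/fsetP => x; rewrite in_fsetI !in_restr !inE; case: (x \in S) => /=; by rewrite !andbF.
Qed.

(** A chain of the join is a pair of chains.  It is matched through its
    first component unless that one is critical, and then through the second;
    critical chains are maximal, so passing to a larger chain can only move
    from the first case to the second. *)
Lemma spherical_poset_join Q1 Q2 e1 e2 N1 N2 :
  (forall x y, Q1 x -> Q2 y -> (x < y)%O) ->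
  spherical_poset Q1 e1 N1 -> spherical_poset Q2 e2 N2 ->
  spherical_poset (Q1 `|` Q2) (e1 + e2) (e2.+2 * maxn N1 N2).
Proof.
move=> Q12 [le1 [m1 Qm1 m1e] [C1 [C1P pm1]]] [le2 [m2 Qm2 m2e] [C2 [C2P pm2]]].
pose S : {pred P} := fun x => `[< Q1 x >].
have SP x : reflect (Q1 x) (x \in S) by apply: (iffP (asboolP _)).
have nS x : Q2 x -> x \notin S.
  by move=> Q2x; apply/SP => Q1x; have := Q12 _ _ Q1x Q2x; rewrite ltxx.
have chainE c : chains_in (Q1 `|` Q2) c <->
    chains_in Q1 (restr S c) /\ chains_in Q2 (restr [predC S] c).
  split=> [[cQ cc]|[[c1 cc1] [c2 cc2]]].
    split; split=> [x|x y]; rewrite !in_restr.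
    - by move=> /andP[_ /SP].
    - by move=> /andP[xc _] /andP[yc _]; apply: cc.
    - by move=> /andP[/cQ[Q1x|//]]; rewrite !inE; move/SP: Q1x => ->.
    - by move=> /andP[xc _] /andP[yc _]; apply: cc.
  have cQ x : x \in c -> (x \in restr S c /\ Q1 x) \/ (x \in restr [predC S] c /\ Q2 x).
    rewrite -{1}(restr_cat S c) in_fsetU => /orP[xc|xc]; [left|right]; split => //.
      exact: c1.
    exact: c2.
  split=> [x /cQ[[_ ?]|[_ ?]]|x y /cQ[[xc Qx]|[xc Qx]] /cQ[[yc Qy]|[yc Qy]]].
  - by left.
  - by right.
  - exact: cc1.
  - by rewrite /Order.comparable (ltW (Q12 _ _ Qx Qy)).
  - by rewrite /Order.comparable (ltW (Q12 _ _ Qy Qx)) orbT.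
  - exact: cc2.
split.
- move=> c /chainE[/le1 c1 /le2 c2]; rewrite -(card_restr_cat S); exact: leq_add.
- have r1 : restr S (m1 `|` m2)%fset = m1.
    apply/fsetP => x; rewrite in_restr in_fsetU.
    case: (boolP (x \in m1)) => [/Qm1.1/SP -> //|_] /=.
    by case: (boolP (x \in m2)) => [/Qm2.1/nS/negbTE ->|].
  have r2 : restr [predC S] (m1 `|` m2)%fset = m2.
    apply/fsetP => x; rewrite in_restr in_fsetU inE.
    case: (boolP (x \in m2)) => [/Qm2.1/nS -> |x2] /=; first by rewrite orbT.
    by rewrite orbF; case: (boolP (x \in m1)) => [/Qm1.1/SP ->|].
  exists (m1 `|` m2)%fset; first by apply/chainE; rewrite r1 r2.
  by rewrite -(card_restr_cat S) r1 r2 m1e m2e.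
pose r1 := restr S; pose r2 := restr [predC S].
exists [set c | C1 (r1 c) /\ C2 (r2 c)]; split.
  move=> c [/C1P[c1 c1e] /C2P[c2 c2e]]; split; first exact/chainE.
  by rewrite -(card_restr_cat S) c1e c2e.
pose lab c : {fset P} + {fset P} := if `[< C1 (r1 c) >] then inl (r1 c) else inr (r2 c).
pose ht (l : {fset P} + {fset P}) := match l with inl _ => e2.+1 | inr m => #|` m| end.
apply: (@perfect_matching_cluster _ _ _ lab ht (maxn N1 N2) e2.+2).
- move=> c [/chainE[_ /le2 c2] _]; rewrite /lab; case: ifP => //= _; exact: ltnW.
- move=> c d [/chainE[_ c2] _] [/chainE[d1 d2] _] cd; rewrite /lab.
  have cd1 : (r1 c `<=` r1 d)%fset := restrS S cd.
  have cd2 : (r2 c `<=` r2 d)%fset := restrS [predC S] cd.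
  case: asboolP => [Cc|Cc].
    have -> : r1 d = r1 c.
      apply/esym/eqP; rewrite eqEfcard cd1 /=.
      by have [_ ->] := C1P _ Cc; exact: le1.
    by rewrite asboolT //; left.
  case: asboolP => [Cd|Cd]; first by right => /=; rewrite ltnS; exact: le2.
  move: cd2; rewrite fsubEproper => /orP[/eqP->|/fproper_ltn_card ?]; by [left|right].
- have [pmN1 pmN2] : perfect_matching [set c | chains_in Q1 c /\ ~ C1 c] (maxn N1 N2) /\
      perfect_matching [set c | chains_in Q2 c /\ ~ C2 c] (maxn N1 N2).
    by split; [apply: perfect_matching_leq pm1; exact: leq_maxl
              |apply: perfect_matching_leq pm2; exact: leq_maxr].
  case=> m.
    have [Cm|nCm] := pselect (C1 m); last first.
      apply: (perfect_matching0 _ pmN1). move=> c [_]; rewrite /lab.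
      by case: asboolP => // Cc [E]; apply: nCm; rewrite -E.
    apply: (perfect_matching_restr (S := [predC S]) (B := m) _ _ pmN2).
      by move=> c [[c2 _] _] x /c2/nS; rewrite !inE.
    have rr c : restr [predC [predC S]] c = r1 c.
      by apply/fsetP => x; rewrite !in_restr !inE negbK.
    move=> c; rewrite rr -/(r2 c); split=> [[[/chainE[c1 c2] nC]]|[[c2 nC] E]].
      rewrite /lab; case: asboolP => // Cc [E]; split => //; split => // C2c.
      by apply: nC.
    have C1c : C1 (r1 c) by rewrite E.
    split; first by split; [apply/chainE; have [] := C1P _ C1c|case].
    by rewrite /lab asboolT // E.
  have [Qm|nQm] := pselect (chains_in Q2 m); last first.
    apply: (perfect_matching0 _ pmN1) => c [[/chainE[_ c2] _]]; rewrite /lab.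
    by case: asboolP => // _ [E]; apply: nQm; rewrite -E.
  apply: (perfect_matching_restr (S := S) (B := m) _ _ pmN1).
    by move=> c [[c1 _] _] x /c1/SP.
  move=> c; rewrite -/(r1 c) -/(r2 c); split=> [[[/chainE[c1 c2] nC]]|[[c1 nC] E]].
    by rewrite /lab; case: asboolP => // Cc [E].
  split; last by rewrite /lab asboolF // E.
  split; last by case.
  by apply/chainE; split => //; rewrite -/(r2 c) E.
Qed.
Lemma chains_in_toggle Q (p : P) c : Q p -> (forall y, y \in c -> (p >=< y)%O) ->
  chains_in Q c -> chains_in Q (toggle p c).
Proof.
move=> Qp pc Qc; rewrite /toggle; case: ifP => _.
  by apply: chains_inS Qc; exact: fsubD1set.
case: Qc => cQ cc; split=> [x|x y]; rewrite !inE.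
  by move=> /orP[/eqP->//|/cQ].
move=> /orP[/eqP->|xc] /orP[/eqP->|yc]; [exact: comparablexx|exact: pc| |exact: cc].
by rewrite comparable_sym; exact: pc.
Qed.

Lemma chain_extremum (r : rel P) c : c != fset0 -> reflexive r -> transitive r ->
  {in c &, forall x y, r x y || r y x} -> exists2 m, m \in c & forall y, y \in c -> r m y.
Proof.
move=> /fset0Pn[x0 x0c] rr tr cr.
suff H (s : seq P) : {subset s <= c} -> x0 \in s ->
    exists2 m, m \in c & forall y, y \in s -> r m y.
  by apply: (H (enum_fset c)) => // x.
have : s != [::] -> {subset s <= c} ->
    exists2 m, m \in c & forall y, y \in s -> r m y.
  elim: s => // x [|y s] IH _ sc.
    exists x; first by apply: sc; rewrite inE.
    by move=> y; rewrite inE => /eqP->.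
  have xc : x \in c by apply: sc; rewrite inE eqxx.
  have [//|z zs|m mc my] := IH; first by apply: sc; rewrite inE zs orbT.
  have /orP[xm|mx] := cr _ _ xc mc.
    by exists x => // z; rewrite inE => /orP[/eqP->|/my]; [exact: rr|exact: tr xm].
  by exists m => // z; rewrite inE => /orP[/eqP->|/my].
by case: s => // x s H sc _; exact: H.
Qed.

Lemma chain_min c : c != fset0 -> {in c &, forall x y, (x >=< y)%O} ->
  exists2 m, m \in c & forall y, y \in c -> (m <= y)%O.
Proof. move=> c0; apply: chain_extremum => //; exact: le_trans. Qed.

Lemma chain_max c : c != fset0 -> {in c &, forall x y, (x >=< y)%O} ->
  exists2 m, m \in c & forall y, y \in c -> (y <= m)%O.
Proof.
move=> c0 cc; apply: (chain_extremum (r := fun x y => (y <= x)%O)) => //.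
  by move=> x y z xy yz; exact: le_trans yz xy.
by move=> x y xc yc; rewrite orbC; exact: cc.
Qed.
End Chains.

(** * The Solomon-Tits argument for families of subspaces *)

Section SubspacePosets.
Context (disp : Order.disp_t) (P : porderType disp) (F : fieldType) (E : vectType F).
Context (phi : P -> {vspace E}) (G : {vspace E} -> Prop).
Hypothesis phi_le : forall x y, (x <= y)%O = (phi x <= phi y)%VS.
Hypothesis G_phi : forall U, G U -> U != 0%VS -> exists x, phi x = U.
Hypothesis G_sub : forall U U', (U' <= U)%VS -> G U -> G U'.
Implicit Types (c d : {fset P}) (A U H : {vspace E}).

Definition above A : set P := [set x | [/\ G (phi x), (A <= phi x)%VS & A != phi x]].

Lemma above_ex A U : G U -> (A <= U)%VS -> A != U -> exists2 x, above A x & phi x = U.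
Proof.
move=> GU AU neq; have [|x xU] := G_phi GU.
  by apply: contra neq => /eqP U0; move: AU; rewrite U0 subv0 eq_sym.
by exists x => //; split; rewrite xU.
Qed.

Lemma phi_dim x y : (x <= y)%O -> (\dim (phi y) <= \dim (phi x))%N -> x = y.
Proof.
rewrite phi_le => xy d; apply/le_anti; rewrite !phi_le xy /=.
have /eqP -> : phi x == phi y by rewrite eqEdim xy.
exact: subvv.
Qed.

Lemma chain_size A (r : nat) c : (forall U, G U -> (\dim U <= r)%N) ->
  chains_in (above A) c -> (#|` c| <= r - \dim A)%N.
Proof.
move=> Gr [cA cc]; rewrite -(size_map (fun x => \dim (phi x))).
rewrite -(size_iota (\dim A).+1 (r - \dim A)); apply: uniq_leq_size.
  rewrite map_inj_in_uniq ?fset_uniq // => x y xc yc dxy.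
  have /orP[xy|yx] := cc x y xc yc; first by apply: phi_dim; rewrite ?dxy.
  by apply/esym/phi_dim; rewrite ?dxy.
move=> _ /mapP[x /cA[Gx Ax nAx] ->]; rewrite mem_iota.
have : (\dim A < \dim (phi x))%N.
  by rewrite ltn_neqAle dimvS // andbT; apply: contra nAx => /eqP dA; rewrite eqEdim Ax dA leqnn.
by have := Gr _ Gx; lia.
Qed.

(** The zigzag [U >= U :&: H <= (U :&: H) + <v> >= A + <v>] as a matching.
    If some members of a chain are not inside [H], the intersection of [H]
    with the least of them is comparable with the whole chain, and can be
    added or removed.  Otherwise, if some members do not contain [v], the
    greatest of them plus [v] can be used, and if there is none, [A + <v>]. *)
Lemma deleted_matching A H v (D : nat) :
  (A <= H)%VS -> v \in H -> v \notin A -> G A ->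
  (forall U, G U -> (A <= U)%VS -> (U <= H)%VS -> G (U + <[v]>)%VS) ->
  (forall c, chains_in (above A) c -> (#|` c| <= D)%N) ->
  perfect_matching (chains_in [set x | above A x /\ (phi x :&: H)%VS != A])
    (D.+1 * (D.+1 * D.+1)).
Proof.
move=> AH vH vA GA GH cD; set Q := [set x | _].
have QA c : chains_in Q c -> chains_in (above A) c.
  by case=> cQ cc; split => // x /cQ[].
have vAv : v \in (A + <[v]>)%VS by rewrite (subvP (addvSr _ _)) ?memv_line.
have [pA pAA phipA] : exists2 x, above A x & phi x = (A + <[v]>)%VS.
  apply: above_ex; [exact: GH|exact: addvSl|].
  by apply: contra vA => /eqP ->.
have AvH : (A + <[v]> <= H)%VS by rewrite subv_add AH -memvE.
have Q_H x : above A x -> (phi x <= H)%VS -> Q x.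
  by move=> Ax xH; split => //; rewrite (capv_idPl xH) eq_sym; case: Ax.
have pmcone (F0 : set {fset P}) p : (forall c, F0 c -> chains_in Q c) ->
    (forall c, F0 c -> F0 (toggle p c)) -> perfect_matching F0 D.+1.
  by move=> FQ Fp; apply: (perfect_matching_cone Fp) => c /FQ/QA/cD.
have pm0 (F0 : set {fset P}) : (forall c, ~ F0 c) -> perfect_matching F0 D.+1.
  by move=> F_0; apply: (pmcone _ pA) => c /F_0.
have toggleS (S : {pred P}) p c e' : p \notin S -> restr S c = e' -> restr S (toggle p c) = e'.
  move=> pS <-; apply/fsetP => x; rewrite !in_restr in_toggle.
  by case: eqVneq => [->|]; rewrite ?(negbTE pS) ?andbF ?addbF.
pose S1 : {pred P} := fun x => ~~ (phi x <= H)%VS.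
pose S2 : {pred P} := fun x => v \notin phi x.
(* First split according to the members not inside [H], then, if there are
   none, according to those that do not contain [v]. *)
apply: (@perfect_matching_split _ _ S1) => [c /QA/cD//|e].
have [->|e0] := eqVneq e fset0.
  apply: (@perfect_matching_split _ _ S2) => [c [/QA/cD//]|e2].
  have cH c : restr S1 c = fset0 -> forall x, x \in c -> (phi x <= H)%VS.
    move=> c0 x xc; apply: contraT => xH.
    by have : x \in restr S1 c; [rewrite in_restr xc|rewrite c0].
  have [->|e20] := eqVneq e2 fset0.
    apply: (pmcone _ pA) => [c [[]] //|c [[Qc c1] c2]]; split; first split.
    + apply: chains_in_toggle => // [|y yc]; first by apply: Q_H; rewrite ?phipA.
      have [_ Ay _] := (Qc.1 y yc).1; have vy : v \in phi y.
        apply: contraT => vy.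
        by have : y \in restr S2 c; [rewrite in_restr yc|rewrite c2].
      by rewrite /Order.comparable !phi_le phipA subv_add Ay -memvE vy.
    + by apply: toggleS => //; rewrite /S1 unfold_in phipA negbK.
    + by apply: toggleS => //; rewrite /S2 unfold_in phipA negbK.
  have [[c0 [[Qc0 c01] c0e]]|none] := pselect (exists c, (chains_in Q c /\ restr S1 c = fset0) /\
      restr S2 c = e2); last first.
    by apply: pm0 => c Fc; apply: none; exists c.
  have e2c c : restr S2 c = e2 -> (e2 `<=` c)%fset.
    by move=> <-; apply/fsubsetP => x; rewrite in_restr => /andP[].
  have [m me mmax] : exists2 m, m \in e2 & forall y, y \in e2 -> (y <= m)%O.
    by apply: chain_max e20 _ => x y xe ye; apply: Qc0.2; exact: (fsubsetP (e2c _ c0e)).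
  have mS2 : v \notin phi m by move: me; rewrite -c0e in_restr => /andP[].
  have mc c : restr S2 c = e2 -> m \in c by move/e2c/fsubsetP; apply.
  have [Am nA] : above A m /\ (phi m :&: H)%VS != A := Qc0.1 m (mc _ c0e).
  have [Gm sAm nAm] := Am.
  have mH : (phi m <= H)%VS := cH _ c01 _ (mc _ c0e).
  have [p Ap phip] : exists2 x, above A x & phi x = (phi m + <[v]>)%VS.
    apply: above_ex; [exact: GH|exact: subv_trans sAm (addvSl _ _)|].
    apply: contra vA => /eqP ->; by rewrite (subvP (addvSr _ _)) ?memv_line.
  have pH : (phi p <= H)%VS by rewrite phip subv_add mH -memvE.
  have vp : v \in phi p by rewrite phip (subvP (addvSr _ _)) ?memv_line.
  apply: (pmcone _ p) => [c [[]] //|c [[Qc c1] c2]]; split; first split.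
  + apply: chains_in_toggle => // [|y yc]; first exact: Q_H.
    rewrite /Order.comparable !phi_le phip.
    case: (boolP (v \in phi y)) => vy.
      rewrite subv_add -memvE vy andbT.
      have /orP[my|ym] := Qc.2 m y (mc _ c2) yc; first by rewrite -phi_le my.
      by move: mS2; rewrite phi_le in ym; rewrite (subvP ym).
    have ye : y \in e2 by rewrite -c2 in_restr yc.
    by rewrite (subv_trans _ (addvSl _ _)) ?orbT // -phi_le mmax.
  + by apply: toggleS => //; rewrite /S1 unfold_in pH.
  + by apply: toggleS => //; rewrite /S2 unfold_in negbK.
apply: (@perfect_matching_leq _ _ D.+1); first exact: leq_pmulr.
have [[c0 [Qc0 c0e]]|none] := pselect (exists c, chains_in Q c /\ restr S1 c = e); last first.
  by apply: pm0 => c Fc; apply: none; exists c.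
have ec c : restr S1 c = e -> (e `<=` c)%fset.
  by move=> <-; apply/fsubsetP => x; rewrite in_restr => /andP[].
have [m me mmin] : exists2 m, m \in e & forall y, y \in e -> (m <= y)%O.
  by apply: chain_min e0 _ => x y xe ye; apply: Qc0.2; exact: (fsubsetP (ec _ c0e)).
have mS1 : ~~ (phi m <= H)%VS by move: me; rewrite -c0e in_restr => /andP[].
have mc c : restr S1 c = e -> m \in c by move/ec/fsubsetP; apply.
have [[Gm sAm nAm] nA] : above A m /\ (phi m :&: H)%VS != A := Qc0.1 m (mc _ c0e).
have [p Ap phip] : exists2 x, above A x & phi x = (phi m :&: H)%VS.
  apply: above_ex; [exact: G_sub (capvSl _ _) Gm|by rewrite subv_cap sAm|].
  by rewrite eq_sym.
have pH : (phi p <= H)%VS by rewrite phip capvSr.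
apply: (pmcone _ p) => [c [] //|c [Qc c1]]; split.
+ apply: chains_in_toggle => // [|y yc]; first exact: Q_H.
  rewrite /Order.comparable !phi_le phip.
  case: (boolP (phi y <= H)%VS) => yH.
    have /orP[my|ym] := Qc.2 m y (mc _ c1) yc; [rewrite phi_le in my|rewrite phi_le in ym].
      by move: mS1; rewrite (subv_trans my).
    by rewrite subv_cap ym yH orbT.
  have ye : y \in e by rewrite -c1 in_restr yc.
  by rewrite (subv_trans (capvSl _ _)) // -phi_le mmin.
+ by apply: toggleS => //; rewrite /S1 unfold_in pH.
Qed.

Hypothesis inhabited_P : P.

(** The complement of the poset of [deleted_matching] consists of the
    [U] with [U :&: H = A].  They have dimension one more than [A], hence a
    chain contains at most one of them, and all the other members of such a
    chain lie above it: induction applies to the poset above it. *)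
Lemma spherical_above (r : nat) :
  (forall U, G U -> (\dim U <= r)%N) ->
  (forall A, G A -> (\dim A < r)%N -> exists v H,
    [/\ (A <= H)%VS, v \in H, v \notin A,
      forall U, G U -> (A <= U)%VS -> (U <= H)%VS -> G (U + <[v]>)%VS &
      forall U, G U -> (A <= U)%VS -> (\dim U <= (\dim (U :&: H)).+1)%N]) ->
  forall k, exists N, forall A, G A -> (\dim A + k)%N = r ->
  spherical_poset (above A) k N.
Proof.
move=> Gr Gext; elim=> [|k [N IH]].
  exists 1%N => A GA; rewrite addn0 => dA.
  have cA c : chains_in (above A) c -> c = fset0.
    by move=> /(chain_size Gr); rewrite dA subnn leqn0 cardfs_eq0 => /eqP.
  have c0 : chains_in (above A) fset0 by split.
  split; [by move=> c /cA ->; rewrite cardfs0|by exists fset0; rewrite ?cardfs0|].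
  exists [set fset0]; split; first by move=> _ ->; rewrite cardfs0.
  apply: (@perfect_matching_cone _ _ inhabited_P 0) => c [/cA -> nC]; by case: nC.
exists (k.+2 * maxn N (k.+2 * (k.+2 * k.+2)))%N => A GA dA.
have [|v [H [AH vH vA GH codim]]] := Gext A GA; first by rewrite -dA; lia.
have leA c : chains_in (above A) c -> (#|` c| <= k.+1)%N.
  by move/(chain_size Gr) => /leq_trans -> //; rewrite -dA; lia.
pose S : {pred P} := fun x => (phi x :&: H)%VS == A.
have zdim z : above A z -> z \in S -> (\dim A < \dim (phi z))%N /\ (\dim (phi z) = (\dim A).+1)%N.
  move=> [Gz Az nAz] /eqP zS.
  have d1 : (\dim A < \dim (phi z))%N.
    rewrite ltn_neqAle dimvS // andbT; apply: contra nAz => /eqP dz.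
    by rewrite eqEdim Az dz leqnn.
  split => //; apply/eqP; rewrite eqn_leq d1 andbT.
  by have := codim _ Gz Az; rewrite zS.
(* A dimension count separates the deleted members from those above them. *)
have zup z : above A z -> z \in S -> forall x, above (phi z) x -> x \notin S.
  move=> Az zS x [Gx zx nzx]; apply/negP => xS.
  have [_ dz] := zdim z Az zS.
  have Ax : above A x.
    split => //; first by apply: subv_trans zx; case: Az.
    apply: contra nzx => /eqP Ax; rewrite eqEsubv zx /= -Ax.
    by case: Az.
  have [_ dx] := zdim x Ax xS.
  by move: nzx; rewrite eqEdim zx dx dz leqnn.
have aboveS z : above A z -> above (phi z) `<=` above A.
  move=> [Gz Az nAz] x [Gx zx nzx]; split => //; first exact: subv_trans zx.
  by apply: contra nAz => /eqP Ax; rewrite eqEsubv Az /= Ax.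
have sphz z : above A z -> z \in S -> spherical_poset (above (phi z)) k N.
  by move=> Az zS; have [_ dz] := zdim z Az zS; apply: IH; [case: Az|rewrite dz; lia].
have chainz z c : above A z -> z \in S -> restr S c = [fset z]%fset ->
    chains_in (above A) c <-> chains_in (above (phi z)) (restr [predC S] c).
  move=> Az zS cz; have [_ dz] := zdim z Az zS.
  have zc : z \in c.
    by have : z \in restr S c; [rewrite cz inE|rewrite in_restr => /andP[]].
  split=> [[cA cc]|[cA cc]].
    split=> [x|x y]; rewrite !in_restr !inE => /andP[xc xS]; last first.
      by move=> /andP[yc _]; exact: cc.
    have Ax := cA _ xc; have [Gx sAx nAx] := Ax.
    have xz : x != z by apply: contraNneq xS => ->.
    have /orP[zx|xz'] := cc z x zc xc.
      split; [by []|by rewrite -phi_le|].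
      apply: contra xz => /eqP zx'; apply/eqP; apply/esym; apply: phi_dim => //.
      by rewrite zx'.
    case/negP: xz; apply/eqP; apply: phi_dim => //; rewrite dz.
    rewrite ltn_neqAle dimvS // andbT; apply: contra nAx => /eqP dAx.
    by rewrite eqEdim sAx dAx leqnn.
  have cE x : x \in c -> x = z \/ x \in restr [predC S] c.
    rewrite -{1}(restr_cat S c) cz in_fsetU inE => /orP[/eqP|]; by [left|right].
  split=> [x /cE[->//|/cA]|x y /cE[->|xc] /cE[->|yc]].
  - exact: aboveS.
  - exact: comparablexx.
  - by rewrite /Order.comparable phi_le; have [_ -> _] := cA _ yc.
  - by rewrite /Order.comparable !phi_le; have [_ -> _] := cA _ xc; rewrite orbT.
  - exact: cc.
have /choice[Cz CzP] : forall z, exists C : set {fset P}, above A z -> z \in S ->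
    (forall c, C c -> chains_in (above (phi z)) c /\ #|` c| = k) /\
    perfect_matching [set c | chains_in (above (phi z)) c /\ ~ C c] N.
  move=> z; have [[Az zS]|nz] := pselect (above A z /\ z \in S).
    by have [_ _ [C [CP pm]]] := sphz z Az zS; exists C.
  by exists set0 => Az zS; case: nz.
split => //.
  have [z Az zE] : exists2 z, above A z & phi z = (A + <[v]>)%VS.
    apply: above_ex; [exact: GH|exact: addvSl|].
    by apply: contra vA => /eqP ->; rewrite (subvP (addvSr _ _)) ?memv_line.
  have dz : \dim (phi z) = (\dim A).+1.
    have [Gz sAz nAz] := Az; apply/eqP; rewrite eqn_leq zE.
    rewrite (leq_trans (dimv_add_leqif _ _)) ?dim_vline; last by case: (v != 0); rewrite ?addn1 ?addn0.
    rewrite -zE ltn_neqAle dimvS // andbT; apply: contra nAz => /eqP dAx.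
    by rewrite eqEdim sAz dAx leqnn.
  have [||_ [c [cA cc] ck] _] := IH (phi z); first by case: Az.
    by rewrite dz; lia.
  exists (z |` c)%fset; last first.
    rewrite cardfsU1 ck; case: (boolP (z \in c)) => // /cA[_ _].
    by rewrite eqxx.
  split=> [x|x y]; rewrite !inE.
    by move=> /orP[/eqP->//|/cA]; exact: aboveS.
  move=> /orP[/eqP->|xc] /orP[/eqP->|yc]; [exact: comparablexx| | |exact: cc].
    by rewrite /Order.comparable phi_le; have [_ -> _] := cA _ yc.
  by rewrite /Order.comparable !phi_le; have [_ -> _] := cA _ xc; rewrite orbT.
exists [set c | exists z, [/\ above A z, z \in S, restr S c = [fset z]%fset &
   Cz z (restr [predC S] c)]]; split.
  move=> c [z [Az zS cz Cc]]; have [CP _] := CzP z Az zS; have [cc ck] := CP _ Cc.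
  split; first exact/(chainz z).
  by rewrite -(card_restr_cat S) cz cardfs1 ck.
(* The part of a chain in [S] is empty, which is the deleted poset, or a
   single [z], which leaves a chain above [z]. *)
apply: (@perfect_matching_split _ _ S) => [c [/leA //]|e].
have pm0 : perfect_matching (chains_in [set x | above A x /\ (phi x :&: H)%VS != A])
    (maxn N (k.+2 * (k.+2 * k.+2))).
  apply: perfect_matching_leq (deleted_matching AH vH vA GA _ leA); first exact: leq_maxr.
  by move=> U GU AU; exact: GH.
have [-> {e}|e0] := eqVneq e fset0.
  congr (perfect_matching _ _): pm0; apply/seteqP; split=> c /=.
    move=> [cQ cc]; split; last first.
      apply/fsetP => x; rewrite in_restr inE; apply/negP => /andP[/cQ[_ /negP]]; exact.
    split; first by split => // x /cQ[].
    move=> [z [_ zS cz _]]; have : z \in restr S c by rewrite cz inE.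
    by rewrite in_restr => /andP[/cQ[_ /negP]]; exact.
  move=> [[[cA cc] _] cS]; split => // x xc; split; first exact: cA.
  apply/negP => xS; have : x \in restr S c by rewrite in_restr xc.
  by rewrite cS.
have [[z [Az zS ze]]|none] :=
    pselect (exists z, [/\ above A z, z \in S & e = [fset z]%fset]); last first.
  apply: (perfect_matching0 _ pm0) => c [[[cA cc] _] ce]; apply: none.
  have /fset0Pn[z ze] := e0; exists z.
  have [zc zS] : z \in c /\ z \in S by move: ze; rewrite -ce in_restr => /andP[].
  split => //; first exact: cA.
  apply/fsetP => x; rewrite inE; apply/idP/eqP => [|-> //]; rewrite -ce in_restr => /andP[xc xS].
  have [_ dz] := zdim z (cA _ zc) zS; have [_ dx] := zdim x (cA _ xc) xS.
  have /orP[xz|zx] := cc x z xc zc; first by apply: phi_dim; rewrite ?dx ?dz.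
  by apply/esym/phi_dim; rewrite ?dx ?dz.
have [_ /(perfect_matching_leq (leq_maxl _ (k.+2 * (k.+2 * k.+2)))) pmz] := CzP z Az zS.
apply: (perfect_matching_restr (S := [predC S]) (B := [fset z]%fset) _ _ pmz).
- by move=> c [[cA _] _] x /cA; exact: zup.
- have rr c : restr [predC [predC S]] c = restr S c.
    by apply/fsetP => x; rewrite !in_restr !inE negbK.
  move=> c; rewrite rr ze; split=> [[[cA nC] cz]|[[cA nC] cz]].
    split => //; split; first exact/(chainz z).
    by move=> Cc; apply: nC; exists z.
  split => //; split; first exact/(chainz z).
  move=> [z' [_ _ cz' Cc]]; apply: nC.
  have zz' : z = z' by apply/fset1P; rewrite -cz' cz inE.
  by rewrite zz'.
Qed.
End SubspacePosets.

(** * Isotropic subspaces *)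

Section SymplecticSpace.
Context (n : nat).
Local Notation E := 'rV[rat]_(n + n).

Lemma omega_linear (u : E) : linear (omega u : E -> rat^o).
Proof.
move=> a v w; rewrite /omega scaler_sumr -big_split /=; apply: eq_bigr => i _.
by rewrite !mxE /GRing.scale /=; ring.
Qed.

HB.instance Definition _ (u : E) :=
  GRing.isLinear.Build rat E rat^o _ (omega u) (omega_linear u).

Definition perp (u : E) : {vspace E} := lker (linfun (omega u : E -> rat^o)).

Lemma mem_perp (u v : E) : (v \in perp u) = (omega u v == 0).
Proof. by rewrite memv_ker lfunE. Qed.

Lemma omega_sym0 (u v : E) : (omega u v == 0) = (omega v u == 0).
Proof. by rewrite omega_anti oppr_eq0. Qed.

Lemma omega_self (u : E) : omega u u = 0.
Proof. by rewrite /omega big1 // => i _; rewrite mulrC subrr. Qed.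

Lemma perp_codim (u : E) (U : {vspace E}) : (\dim U <= (\dim (U :&: perp u)).+1)%N.
Proof.
have dU := limg_ker_dim (linfun (omega u : E -> rat^o)) U.
have d1 : (\dim (linfun (omega u : E -> rat^o) @: U) <= 1)%N.
  by rewrite (leq_trans (dimvS (subvf _))) // dimvf.
have := leq_add (leqnn (\dim (U :&: perp u))) d1.
by rewrite addn1; apply: leq_trans; apply: eq_leq; exact/esym.
Qed.

Lemma isotropicS (U U' : {vspace E}) : (U' <= U)%VS -> isotropic U -> isotropic U'.
Proof. by move=> /subvP UU iU u v /UU uU /UU; exact: iU. Qed.

Lemma isotropic_line (U : {vspace E}) (v : E) : isotropic U -> (U <= perp v)%VS ->
  isotropic (U + <[v]>)%VS.
Proof.
move=> iU /subvP Uv u w /memv_addP[u1 u1U [_ /vlineP[a ->] ->]].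
move=> /memv_addP[w1 w1U [_ /vlineP[b ->] ->]].
have uv : omega u1 v = 0 by apply/eqP; rewrite omega_sym0 -mem_perp Uv.
have vw : omega v w1 = 0 by apply/eqP; rewrite -mem_perp Uv.
have omegaL (x y : E) c : omega (x + c *: v) y = omega x y + c * omega v y.
  rewrite omega_anti linearD linearZ /= [omega y x]omega_anti [omega y v]omega_anti.
  by rewrite scalerN -opprD opprK.
rewrite omegaL !linearD !linearZ /= iU // uv vw omega_self.
by rewrite !scaler0 !addr0 mulr0.
Qed.

Definition basis_mx (U : {vspace E}) : 'M[rat]_(\dim U, n + n) :=
  \matrix_(i < \dim U) (vbasis U)`_i.

Lemma basis_mx_rank (U : {vspace E}) : \rank (basis_mx U) = \dim U.
Proof.
apply/eqP/inj_row_free => x; rewrite mulmx_sum_row => x0.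
have /freeP/(_ (fun i => x 0 i)) := basis_free (vbasisP U).
move=> H; apply/rowP => i; rewrite mxE; apply: H.
by rewrite -[RHS]x0; apply: eq_bigr => j _; rewrite rowK.
Qed.

Definition symp_mx : 'M[rat]_(n + n) := block_mx 0 (- 1%:M) 1%:M 0.

Lemma symp_mx_sqr : symp_mx *m symp_mx = - 1%:M.
Proof.
rewrite /symp_mx mulmx_block !(mul0mx, mulmx0, add0r, addr0, mulmx1, mul1mx).
by rewrite [in RHS]scalar_mx_block opp_block_mx !oppr0.
Qed.

Lemma symp_mx_free : row_free symp_mx.
Proof.
apply: inj_row_free => x x0; have := congr1 (mulmx^~ symp_mx) x0.
by rewrite /= mul0mx -mulmxA symp_mx_sqr mulmxN mulmx1 => /eqP; rewrite oppr_eq0 => /eqP.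
Qed.

Lemma mul_symp_mx (v : E) : v *m symp_mx = row_mx (rsubmx v) (- lsubmx v).
Proof.
rewrite -{1}(hsubmxK v) /symp_mx mul_row_block !mulmx0 add0r addr0 mulmx1.
by rewrite mulmxN mulmx1.
Qed.

Lemma omega_mx (u v : E) : omega u v = (u *m (v *m symp_mx)^T) 0 0.
Proof.
rewrite mul_symp_mx mxE big_split_ord /= /omega -big_split /=; apply: eq_bigr => i _.
by rewrite !(mxE trmx_key) row_mxEl row_mxEr !mxE mulrN.
Qed.

(** [U] and its image under the symplectic matrix are orthogonal for the
    standard dot product, so twice the dimension of [U] is at most [n + n]. *)
Lemma isotropic_dim (U : {vspace E}) : isotropic U -> (\dim U <= n)%N.
Proof.
move=> iU; have : basis_mx U *m (basis_mx U *m symp_mx)^T = 0.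
  apply/matrixP => i j.
  have := omega_mx (vbasis U)`_i (vbasis U)`_j.
  rewrite iU ?vbasis_mem ?mem_nth ?size_tuple // !mxE => E0.
  rewrite [RHS]E0; apply: eq_bigr => k _; rewrite !mxE; congr (_ * _).
  by apply: eq_bigr => l _; rewrite !mxE.
move/mulmx0_rank_max; rewrite mxrank_tr mxrankMfree ?symp_mx_free // basis_mx_rank.
lia.
Qed.

(** Each orthogonality condition lowers the dimension by at most one, so
    the vectors orthogonal to [U] cannot all lie in [U]. *)
Lemma isotropic_perp_ex (U : {vspace E}) : (\dim U < n)%N ->
  exists2 v, v \notin U & (U <= perp v)%VS.
Proof.
move=> Un; have H (s : seq E) : exists P : {vspace E}, (n + n <= \dim P + size s)%N /\
    forall u v, u \in s -> v \in P -> omega u v = 0.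
  elim: s => [|u s [P [dP oP]]].
    by exists fullv; rewrite dimvf /dim /= mul1n addn0; split.
  exists (P :&: perp u)%VS; split=> [|u' v].
    by have := perp_codim u P; rewrite /= addnS; lia.
  rewrite inE memv_cap => /orP[/eqP->|us] /andP[vP vu]; last exact: oP.
  by apply/eqP; rewrite -mem_perp.
have [P [dP oP]] := H (vbasis U).
have : ~~ (P <= U)%VS.
  by apply/negP => /dimvS; move: dP; rewrite size_tuple; lia.
move=> /subvPn[v vP vU]; exists v => //.
rewrite -(span_basis (vbasisP U)); apply/span_subvP => u uU.
by rewrite mem_perp omega_sym0 oP.
Qed.
End SymplecticSpace.

(** * From posets to spherical complexes *)

Lemma matching_contractible (R : realType) (V : choiceType) (K : simplicialComplex V)
    (e N : nat) :
  (forall c, K c -> (#|` c| <= e)%N) ->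
  perfect_matching [set c | c = fset0 \/ K c] N -> contractible R (realization R K).
Proof.
move=> Ke pm.
have C0 (c : {fset V}) : (set0 : set {fset V}) c -> K c /\ #|` c| = e by [].
have pm' : perfect_matching (coned K set0) N.
  by congr (perfect_matching _ _): pm; apply/seteqP; split=> c /=; [split=> //; case|case].
apply: homotopy_equivalent_trans (cone_equivalent R Ke C0 pm') _.
have c0 : coned K set0 fset0 by split=> //; left.
by apply: cone_contractible => // c [].
Qed.

(** If [C] is empty the cone is contractible.  Otherwise it is
    equivalent to a wedge of spheres indexed by [C]. *)
Lemma spherical_of_poset (R : realType) (disp : Order.disp_t) (P : porderType disp)
    (Q : set P) (K : simplicialComplex P) (e N : nat) :
  (forall t, K t <-> t != fset0 /\ chains_in Q t) -> spherical_poset Q e N ->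
  spherical R K (e%:Z - 1).
Proof.
move=> KE [le [c0 Qc0 c0e] [C [CP pm]]]; split.
  split=> [s /KE[_ /le se]|]; first by rewrite /simplex_dim lerD2r lez_nat.
  case: e le c0e CP pm => [|m] le c0e CP pm; [right|left].
    split => // s /KE[s0 /le]; rewrite leqn0 cardfs_eq0; exact/negP.
  exists c0; last by rewrite /simplex_dim c0e.
  by apply/KE; split => //; rewrite -cardfs_eq0 c0e.
case: e le c0e CP pm => [|m] // le c0e CP pm.
have -> : m.+1%:Z - 1 = m by rewrite -addn1 PoszD addrK.
have augE c : aug K c <-> chains_in Q c.
  split=> [[->|/KE[]//]|Qc]; first by split.
  by have [->|c_0] := eqVneq c fset0; [left|right; apply/KE].
have Kle c : K c -> (#|` c| <= m.+1)%N by move=> /KE[_ /le].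
have C_top c : C c -> K c /\ #|` c| = m.+1.
  move=> /CP[Qc ce]; split => //; apply/KE; split => //.
  by rewrite -cardfs_eq0 ce.
have pm' : perfect_matching (coned K C) N.
  by congr (perfect_matching _ _): pm; apply/seteqP; split=> c [/augE ? ?].
have coned0 : coned K C fset0.
  split; first by left.
  by move=> /CP[_]; rewrite cardfs0.
have KX := cone_equivalent R Kle C_top pm'.
have [[c Cc]|noC] := pselect (exists c, C c); last first.
  left; apply: homotopy_equivalent_trans KX _.
  by apply: cone_contractible => // c Cc; apply: noC; exists c.
right; have [Kc _] := C_top _ Cc; have /fset0Pn[v0 _] := simplex_neq0 Kc.
pose i0 : {c | `[< C c >]} := exist _ c (asboolT Cc).
exists {c | `[< C c >]}; split; first by constructor.
apply: homotopy_equivalent_trans KX _.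
exact: cone_wedge_equivalent v0 coned0 i0.
Qed.

(** A complement in [V] of a further vector [u], chosen so as to contain
    [A] and [v]. *)
Lemma hyperplane_ex (F : fieldType) (E : vectType F) (A V : {vspace E}) :
  (A <= V)%VS -> ((\dim A).+1 < \dim V)%N ->
  exists v H, [/\ (A <= H)%VS, v \in H, v \notin A, (H <= V)%VS & \dim V = (\dim H).+1].
Proof.
move=> AV dAV.
have ex (B : {vspace E}) : (B <= V)%VS -> (\dim B < \dim V)%N ->
    exists2 v, v \in V & v \notin B.
  move=> BV dB; apply/subvPn; apply/negP => /dimvS; lia.
have dline (B : {vspace E}) v : (\dim (B + <[v]>) <= (\dim B).+1)%N.
  by rewrite (leq_trans (dimv_add_leqif _ _)) // dim_vline; case: (v != 0); lia.
have [v vV vA] := ex A AV (ltnW dAV).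
pose B := (A + <[v]>)%VS; have BV : (B <= V)%VS by rewrite subv_add AV -memvE.
have [u uV uB] := ex B BV (leq_ltn_trans (dline _ _) dAV).
pose B' := (B + <[u]>)%VS; have B'V : (B' <= V)%VS by rewrite subv_add BV -memvE.
pose H := (B + (V :\: B'))%VS.
have BH : (B <= H)%VS by exact: addvSl.
have HV : (H <= V)%VS by rewrite subv_add BV diffvSl.
have Hu : (H + <[u]>)%VS = V.
  rewrite /H -addvA [(V :\: B' + _)%VS]addvC addvA -/B' addvC addv_diff.
  exact/addv_idPl.
exists v, H; split => //.
- exact: subv_trans (addvSl _ _) BH.
- by rewrite (subvP BH) // (subvP (addvSr _ _)) ?memv_line.
- have dB' : (\dim B < \dim B')%N.
    rewrite ltn_neqAle dimvS ?addvSl // andbT; apply: contra uB => /eqP dBB.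
    have /eqP -> : B == B' by rewrite eqEdim addvSl -dBB leqnn.
    by rewrite (subvP (addvSr _ _)) ?memv_line.
  have dH : (\dim H <= \dim B + \dim (V :\: B'))%N by rewrite (dimv_add_leqif _ _).
  have dV := dimv_cap_compl V B'; rewrite (capv_idPr B'V) in dV.
  have dHu := dline H u; rewrite Hu in dHu.
  lia.
Qed.

(** * Links in the poset of isotropic subspaces of W *)

Section IntervalsAndLinks.
Context (n : nat) (n_gt0 : (0 < n)%N).
Local Notation E := 'rV[rat]_(n + n).
Local Notation P := (TomegaW n).

Let last_lt : (n.-1 < n)%N. Proof. by rewrite ltn_predL. Qed.
Let last : 'I_n := Ordinal last_lt.

Definition vertex_space (x : P) : {vspace E} := val (val x).
Local Notation phi := vertex_space.

Lemma vertex_space_le (x y : P) : (x <= y)%O = (phi x <= phi y)%VS.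
Proof. by []. Qed.

Definition isoW (U : {vspace E}) : Prop := isotropic U /\ (U <= W n)%VS.

Lemma isoWS (U U' : {vspace E}) : (U' <= U)%VS -> isoW U -> isoW U'.
Proof. by move=> UU [iU UW]; split; [exact: isotropicS iU|exact: subv_trans UW]. Qed.

Lemma isoW_vertex (x : P) : isoW (phi x) /\ phi x != 0%VS.
Proof.
by case: x => -[U /= UP] /= UW; have /andP[U0 /asboolP iU] := UP; split.
Qed.

Lemma vertex_of_isoW (U : {vspace E}) : isoW U -> U != 0%VS -> exists x : P, phi x = U.
Proof.
move=> [iU UW] U0; have UP : (U != 0%VS) && `[< isotropic U >] by rewrite U0; apply/asboolP.
by exists (exist _ (exist _ U UP) UW).
Qed.

Lemma W_perp : W n = perp (e_ last).
Proof.
apply/eqP; rewrite eqEsubv; apply/andP; split.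
  rewrite subv_add; apply/andP; split; apply/subv_sumP => i.
    by move=> _; rewrite -memvE mem_perp omega_ee.
  move=> ni; rewrite -memvE mem_perp omega_ef.
  by case: (eqVneq last i) => [li|//]; move: ni; rewrite -li /= prednK // ltnn.
apply/subvP => v; rewrite mem_perp => /eqP v0.
rewrite (row_sum_delta v) big_split_ord /=; apply: memv_add.
  by apply: memv_suml => i _; apply: rpredZ; rewrite memvE (sumv_sup i).
rewrite (bigID (fun i : 'I_n => (i.+1 < n)%N)) /= [X in _ + X]big1 ?addr0.
  by apply: memv_suml => i ni; apply: rpredZ; rewrite memvE (sumv_sup i).
move=> i; rewrite -leqNgt => ni; suff -> : v ord0 (rshift n i) = 0 by rewrite scale0r.
have -> : i = last by apply: val_inj => /=; have := ltn_ord i; lia.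
rewrite -v0 /omega (bigD1 last) //= big1 => [|j /negbTE jl].
  by rewrite !mxE !eqxx eq_rlshift !mul1r mul0r subr0 addr0.
by rewrite !mxE eq_lshift jl eq_rlshift !andbF !mul0r subr0.
Qed.

Lemma isoW_dim U : isoW U -> (\dim U <= n)%N.
Proof. by move=> [/isotropic_dim]. Qed.

(** If [A] contains the last [e], then every vector orthogonal to [A] is
    in [W].  If it does not, this [e] itself serves as [v], and [H] is [W]. *)
Lemma isoW_extend A : isoW A -> (\dim A < n)%N -> exists v H,
    [/\ (A <= H)%VS, v \in H, v \notin A,
      forall U, isoW U -> (A <= U)%VS -> (U <= H)%VS -> isoW (U + <[v]>)%VS &
      forall U, isoW U -> (A <= U)%VS -> (\dim U <= (\dim (U :&: H)).+1)%N].
Proof.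
move=> [iA AW] dA.
have [v [vA Av vW]] : exists v, [/\ v \notin A, (A <= perp v)%VS & v \in W n].
  have [eA|eA] := boolP (e_ last \in A).
    have [v vA Av] := isotropic_perp_ex dA; exists v; split => //.
    by rewrite W_perp mem_perp omega_sym0 -mem_perp (subvP Av).
  exists (e_ last); rewrite -W_perp; split => //.
  by rewrite W_perp mem_perp omega_self.
exists v, (perp v); split => //; first by rewrite mem_perp omega_self.
  move=> U [iU UW] _ Uv; split; first exact: isotropic_line.
  by rewrite subv_add UW -memvE.
by move=> U _ _; exact: perp_codim.
Qed.

Definition below (V U : {vspace E}) : Prop := (U <= V)%VS /\ U != V.

Lemma belowS V (U U' : {vspace E}) : (U' <= U)%VS -> below V U -> below V U'.
Proof.
move=> U'U [UV neq]; split; first exact: subv_trans UV.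
by apply: contra neq => /eqP U'V; rewrite eqEsubv UV -U'V.
Qed.

Lemma below_dim V U : below V U -> (\dim U <= (\dim V).-1)%N.
Proof.
move=> [UV neq]; rewrite -ltnS prednK; last first.
  rewrite lt0n dimv_eq0; apply: contra neq => /eqP V0.
  by move: UV; rewrite V0 subv0.
by rewrite ltn_neqAle dimvS // andbT; apply: contra neq => /eqP dUV; rewrite eqEdim UV dUV leqnn.
Qed.

(** Any hyperplane of [V] that contains [A] properly serves as [H]. *)
Lemma below_extend V A : below V A -> (\dim A < (\dim V).-1)%N -> exists v H,
    [/\ (A <= H)%VS, v \in H, v \notin A,
      forall U, below V U -> (A <= U)%VS -> (U <= H)%VS -> below V (U + <[v]>)%VS &
      forall U, below V U -> (A <= U)%VS -> (\dim U <= (\dim (U :&: H)).+1)%N].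
Proof.
move=> [AV _] dA; have [|v [H [AH vH vA HV dV]]] := hyperplane_ex AV; first by lia.
exists v, H; split => //.
  move=> U _ _ UH; have UvH : (U + <[v]> <= H)%VS by rewrite subv_add UH -memvE.
  split; first exact: subv_trans HV.
  by apply: contraTneq UvH => ->; apply/negP => /dimvS; rewrite dV ltnn.
move=> U [UV _] _; have := dimv_sum_cap U H.
have : (\dim (U + H) <= \dim V)%N by apply: dimvS; rewrite subv_add UV.
lia.
Qed.

Lemma spherical_upper k : exists N, forall A, isoW A -> (\dim A + k)%N = n ->
  spherical_poset (above phi isoW A) k N.
Proof.
have [x0 _] : exists x : P, phi x = <[e_ last]>%VS.
  apply: vertex_of_isoW; last first.
    apply: contraTneq (memv_line (e_ last)) => ->; rewrite memv0.
    apply/eqP => /rowP/(_ (lshift n last)).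
    by rewrite !mxE !eqxx.
  split; last by rewrite -memvE W_perp mem_perp omega_self.
  rewrite -[X in isotropic X]add0v; apply: isotropic_line; [|exact: sub0v].
  by move=> u w; rewrite !memv0 => /eqP-> _; rewrite omega_anti linear0 oppr0.
exact: (@spherical_above _ P _ _ phi isoW vertex_space_le vertex_of_isoW isoWS x0 n isoW_dim isoW_extend).
Qed.

Lemma spherical_interval (y : P) A : below (phi y) A ->
  exists N, spherical_poset (above phi (below (phi y)) A) ((\dim (phi y)).-1 - \dim A) N.
Proof.
move=> yA; have [iy _] := isoW_vertex y.
have phi_of U : below (phi y) U -> U != 0%VS -> exists x : P, phi x = U.
  by move=> [Uy _]; apply: vertex_of_isoW; exact: isoWS iy.
have [N HN] := @spherical_above _ P _ _ phi (below (phi y)) vertex_space_le phi_of (@belowS _) y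
  _ (@below_dim _) (@below_extend _) ((\dim (phi y)).-1 - \dim A)%N.
by exists N; apply: HN => //; rewrite subnKC // below_dim.
Qed.

(** For [A = 0] these are the vertices of the link of [s]; the general [A]
    allows the least member of [s] to be split off. *)
Definition link_poset (A : {vspace E}) (s : {fset P}) : set P :=
  [set x | [/\ above phi isoW A x, x \notin s & forall y, y \in s -> (x >=< y)%O]].

(** With [y] the least member of [s], the poset is the join of the interval
    between [A] and [y] and the poset of the same kind for [y] and the
    remaining members. *)
Lemma spherical_link_poset k (s : {fset P}) A : #|` s| = k -> isoW A ->
  chains_in (above phi isoW A) s ->
  exists N, spherical_poset (link_poset A s) (n - \dim A - k) N.
Proof.
elim: k s A => [|k IH] s A sk iA [sA sc].
  have [N HN] := spherical_upper (n - \dim A); exists N.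
  have s0 : s = fset0 by apply/eqP; rewrite -cardfs_eq0 sk.
  have -> : link_poset A s = above phi isoW A.
    by rewrite s0; apply/seteqP; split=> x // [].
  rewrite subn0; apply: HN => //; have := isoW_dim iA; lia.
have s0 : s != fset0 by rewrite -cardfs_eq0 sk.
have [y ys ymin] := chain_min s0 sc.
have [iy Ay nAy] := sA _ ys; pose s' := (s `\ y)%fset.
have s'k : #|` s'| = k by apply: succn_inj; rewrite -sk (cardfsD1 y s) ys.
have yA : below (phi y) A by split.
have phi_inj : injective phi by move=> a b; rewrite /vertex_space => /val_inj/val_inj.
have s'y : chains_in (above phi isoW (phi y)) s'.
  split=> [x|x z]; rewrite !in_fsetD1 => /andP[xy xs]; last by move=> /andP[_ zs]; exact: sc.
  have [ix _ _] := sA _ xs; split => //; first by rewrite -vertex_space_le ymin.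
  by apply: contra xy => /eqP/phi_inj ->.
have [N1 H1] := spherical_interval yA; have [N2 H2] := IH s' (phi y) s'k iy s'y.
have size := chain_size vertex_space_le (@isoW_dim) s'y; rewrite s'k in size.
have dAy : (\dim A < \dim (phi y))%N.
  by rewrite ltn_neqAle dimvS // andbT; apply: contra nAy => /eqP dAy; rewrite eqEdim Ay dAy leqnn.
have := spherical_poset_join _ H1 H2.
have -> : ((\dim (phi y)).-1 - \dim A + (n - \dim (phi y) - k) = n - \dim A - k.+1)%N.
  have := isoW_dim iy; lia.
have -> : above phi (below (phi y)) A `|` link_poset (phi y) s' = link_poset A s.
  apply/seteqP; split=> [x [[[xy nxy] Ax nAx]|[[ix yx nyx] xs' xc]]|x [[ix Ax nAx] xs xc]].
  - have xy' : (x <= y)%O by rewrite vertex_space_le.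
    split.
    + by split => //; exact: isoWS iy.
    + apply: contra nxy => /ymin yx; apply/eqP; congr phi; apply/le_anti.
      by rewrite xy' yx.
    + by move=> z zs; rewrite /Order.comparable (le_trans xy') ?ymin.
  - have yx' : (y <= x)%O by rewrite vertex_space_le.
    have xy : x != y by apply: contra nyx => /eqP ->.
    split.
    + split => //; first exact: subv_trans yx.
      by apply: contra nAy => /eqP Ax; rewrite eqEsubv Ay Ax yx.
    + by move: xs'; rewrite in_fsetD1 xy.
    + move=> z zs; have [->|zy] := eqVneq z y; first by rewrite /Order.comparable yx' orbT.
      by apply: xc; rewrite in_fsetD1 zy.
  - have xy : x != y by apply: contraNneq xs => ->.
    have := xc y ys; rewrite /Order.comparable => /orP[xy'|yx]; [left|right].
      have yx : phi x != phi y by apply: contra xy => /eqP/phi_inj ->.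
      by split; [split; [rewrite -vertex_space_le|]| |].
    have yx' : phi y != phi x by rewrite eq_sym; apply: contra xy => /eqP/phi_inj ->.
    split; first by split; [|rewrite -vertex_space_le|].
      by rewrite in_fsetD1 (negbTE xs) andbF.
    by move=> z; rewrite in_fsetD1 => /andP[_]; exact: xc.
move=> H; exists ((n - \dim (phi y) - k).+2 * maxn N1 N2)%N; apply: H.
move=> x z [[xy nxy] _ _] [[_ yz nyz] _ _].
rewrite lt_neqAle !vertex_space_le (subv_trans xy yz) andbT.
by apply: contra nxy => /eqP xz; rewrite eqEsubv xy xz.
Qed.

End IntervalsAndLinks.

Section OrderComplexOfTomegaW.
Context (n : nat) (n_gt0 : (0 < n)%N).
Local Notation P := (TomegaW n).
Local Notation phi := (@vertex_space n).
Local Notation isoW := (@isoW n).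

Lemma isoW0 : isoW 0%VS.
Proof.
split; last exact: sub0v.
by move=> u w; rewrite !memv0 => /eqP-> _; rewrite omega_anti linear0 oppr0.
Qed.

Lemma above0 (x : P) : above phi isoW 0%VS x.
Proof.
by have [ix x0] := isoW_vertex x; split => //; [exact: sub0v|rewrite eq_sym].
Qed.

Lemma simplex_chain (s : {fset P}) : order_complex P s -> chains_in (above phi isoW 0%VS) s.
Proof. by move=> [_ cs]; split => // x _; exact: above0. Qed.

Lemma simplex_size (s : {fset P}) : order_complex P s -> (#|` s| <= n)%N.
Proof.
move=> /simplex_chain /(chain_size (@vertex_space_le n) (@isoW_dim n)).
by rewrite dimv0 subn0.
Qed.

Lemma order_complex_link (s t : {fset P}) : order_complex P s ->
  link (order_complex P) s t <-> t != fset0 /\ chains_in (link_poset 0%VS s) t.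
Proof.
move=> [s0 sc]; split=> [[t0 st [_ stc]]|[t0 [tl tc]]].
  have stP x : x \in (s `|` t)%fset = (x \in s) || (x \in t) by rewrite in_fsetU.
  split => //; split=> [x xt|x y xt yt]; last by apply: stc; rewrite stP ?xt ?yt orbT.
  split; first exact: above0.
    by apply: contraL xt => /(fdisjointP st).
  by move=> y ys; apply: stc; rewrite stP ?xt ?ys ?orbT.
split => //.
  by apply/fdisjointP => x xs; apply/negP => /tl[_]; rewrite xs.
split=> [|x y].
  by case/fset0Pn: s0 => x xs; apply/fset0Pn; exists x; rewrite in_fsetU xs.
rewrite !in_fsetU => /orP[xs|xt] /orP[ys|yt]; [exact: sc| | |exact: tc].
  by rewrite comparable_sym; have [_ _] := tl _ yt; apply.
by have [_ _] := tl _ xt; apply.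
Qed.

Lemma spherical_order_complex (R : realType) :
  spherical R (order_complex P) (n%:Z - 1).
Proof.
have [N] := spherical_upper n_gt0 n; move=> /(_ 0%VS isoW0); rewrite dimv0 => /(_ erefl).
apply: spherical_of_poset => t; split=> [tP|[t0 [_ tc]]]; last by split.
by split; [exact: simplex_neq0 tP|exact: simplex_chain].
Qed.

Lemma spherical_link (R : realType) (s : {fset P}) : order_complex P s ->
  spherical R (link (order_complex P) s) (n%:Z - 1 - simplex_dim s - 1).
Proof.
move=> sP.
have [N] := spherical_link_poset n_gt0 (erefl #|` s|) isoW0 (simplex_chain sP).
rewrite dimv0 subn0 => HN.
have -> : n%:Z - 1 - simplex_dim s - 1 = (n - #|` s|)%N%:Z - 1.
  by rewrite /simplex_dim -subzn ?simplex_size //; lia.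
by apply: spherical_of_poset HN => t; exact: order_complex_link.
Qed.

(** For [A = 0], [H = W] and [v] the last [e], no vertex is deleted, since
    every isotropic subspace of [W] meets [W] in itself. *)
Lemma order_complex_contractible (R : realType) :
  contractible R (realization R (order_complex P)).
Proof.
have W_iso (x : P) : (phi x <= W n)%VS by have [[]] := isoW_vertex x.
pose last : 'I_n := Ordinal (etrans (ltn_predL n) n_gt0).
have eW : e_ last \in W n by rewrite (W_perp n_gt0) mem_perp omega_self.
have e0 : e_ last \notin (0 : {vspace 'rV[rat]_(n + n)})%VS.
  rewrite memv0; apply/eqP => /rowP/(_ (lshift n last)).
  by rewrite !mxE !eqxx.
have := @deleted_matching _ P _ _ phi isoW (@vertex_space_le n) (@vertex_of_isoW n) (@isoWS n)
  0%VS (W n) (e_ last) n (sub0v _) eW e0 isoW0.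
case=> [U [iU UW] _ _|c [_ cc]|].
- split; last by rewrite subv_add UW -memvE.
  by apply: isotropic_line => //; rewrite -(W_perp n_gt0).
- have [->|c0] := eqVneq c fset0; first by rewrite cardfs0.
  by apply: simplex_size.
move=> a pm.
apply: (@matching_contractible R _ (order_complex P) n _ simplex_size).
congr (perfect_matching _ _) : (ex_intro _ a pm : perfect_matching _ _).
apply/seteqP; split=> c.
  move=> [cQ cc]; have [->|c0] := eqVneq c fset0; [by left|by right].
case=> [->|[c0 cc]]; first by split.
split=> // x _; split; first exact: above0.
rewrite (capv_idPl (W_iso x)); by have [_] := isoW_vertex x.
Qed.
End OrderComplexOfTomegaW.

Theorem theorem2p2 (R : realType) (n : nat) (hn : (1 <= n)%N) :
  contractible R (realization R (order_complex (TomegaW n))) /\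
  cohen_macaulay (TomegaW n) R (n%:Z - 1).
Proof.
split; first exact: order_complex_contractible.
split; first exact: spherical_order_complex.
by move=> s; exact: spherical_link.
Qed.
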